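(* Let $\Omega\subset\mathbb{C}$ be a Jordan domain such that there exists a constant $M<+\infty$ with the property that any two points of $\Omega$ can be joined by a curve inside $\Omega$ of length at most $M$. Let $f$ be a bounded analytic function on $\Omega$. Then the antiderivative of $f$ is also a bounded analytic function on $\Omega$.
   Context: A Jordan domain is the bounded domain enclosed by a Jordan (simple closed) curve in $\mathbb{C}$. An antiderivative of $f$ on $\Omega$ is a holomorphic $F$ on $\Omega$ with $F'=f$; it is unique up to an additive constant, which does not affect the conclusion. *)

(* Defs.v *)
From Stdlib Require Import Reals.
From Coquelicot Require Import Coquelicot.
Open Scope R_scope.

Definition unit_interval (t : R) : Prop := 0 <= t <= 1.

Definition connected (A : C -> Prop) : Prop :=
  forall U V : C -> Prop,
    open U -> open V ->
    (forall z, A z -> U z \/ V z) ->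
    (exists z, A z /\ U z) ->
    (exists z, A z /\ V z) ->
    exists z, A z /\ U z /\ V z.

Definition is_connected_component (A B : C -> Prop) : Prop :=
  (exists z, B z) /\
  (forall z, B z -> A z) /\
  connected B /\
  (forall D : C -> Prop,
     (forall z, D z -> A z) -> connected D ->
     (forall z, B z -> D z) -> forall z, D z -> B z).

Definition bounded_set (A : C -> Prop) : Prop :=
  exists r : R, forall z, A z -> Cmod z <= r.

Definition is_Jordan_curve (J : C -> Prop) : Prop :=
  exists gamma : R -> C,
    continuous_on unit_interval gamma /\
    gamma 0 = gamma 1 /\
    (forall s t, 0 <= s < 1 -> 0 <= t < 1 -> gamma s = gamma t -> s = t) /\
    (forall z, J z <-> exists t, unit_interval t /\ gamma t = z).

(* By the Jordan curve theorem the complement of a Jordan curve has exactly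
   one bounded component, so this determines Omega from its boundary curve. *)
Definition Jordan_domain (Omega : C -> Prop) : Prop :=
  exists J : C -> Prop,
    is_Jordan_curve J /\
    is_connected_component (fun z => ~ J z) Omega /\
    bounded_set Omega.

Definition curve_in (Omega : C -> Prop) (gamma : R -> C) (a b : C) : Prop :=
  continuous_on unit_interval gamma /\
  (forall t, unit_interval t -> Omega (gamma t)) /\
  gamma 0 = a /\ gamma 1 = b.

(* l is the length of the polygon inscribed in gamma at the points of a
   partition 0 = t 0 <= ... <= t (S n) = 1. *)
Definition inscribed_length (gamma : R -> C) (l : R) : Prop :=
  exists (n : nat) (t : nat -> R),
    t 0%nat = 0 /\ t (S n) = 1 /\
    (forall k, (k <= n)%nat -> t k <= t (S k)) /\
    l = sum_f_R0 (fun k => Cmod (gamma (t (S k)) - gamma (t k))%C) n.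

(* Equal to p_infty when the curve is not rectifiable. *)
Definition curve_length (gamma : R -> C) : Rbar :=
  Lub_Rbar (inscribed_length gamma).

(* The functions are total, but only their values on the open set Omega
   matter; derivatives are with respect to the complex variable. *)
Definition holomorphic_on (Omega : C -> Prop) (f : C -> C) : Prop :=
  forall z : C, Omega z ->
    @ex_derive C_AbsRing C_NormedModule f z.

Definition bounded_on (Omega : C -> Prop) (f : C -> C) : Prop :=
  exists B : R, forall z, Omega z -> Cmod (f z) <= B.

Definition is_antiderivative_on (Omega : C -> Prop) (f F : C -> C) : Prop :=
  forall z : C, Omega z ->
    @is_derive C_AbsRing C_NormedModule F z (f z).

(* Main.v *)
Require Import Defs.
From Stdlib Require Import Reals Lra Lia ZArith List Bool Classical ClassicalEpsilon.
From Coquelicot Require Import Coquelicot.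
Open Scope R_scope.

(* The real and imaginary parts of f dz are real 1-forms, closed on Omega by the
   Cauchy-Riemann equations, so it suffices to find potentials of them. Goursat's
   bisection gives a potential on each square inside Omega; potentials on
   overlapping squares are continued along chains. A closed chain is replaced,
   without changing its integral, by a closed walk on a fine lattice, and the
   integral over the walk is the sum over the lattice cells of winding number
   times circulation. The winding number is locally constant on the complement of
   Omega and vanishes far away. That complement is connected, because the Jordan
   curve is, so every cell of nonzero winding number lies in Omega and has zero
   circulation.

   For the bound, F is locally (B + 1)-Lipschitz when |f| <= B, hence
   |F b - F a| is at most (B + 1) times the length of some polygon inscribed in a
   curve from a to b. *)

(** * Topology of Jordan domains *)

(** Only complex differentiability at each point is assumed of [f]; its derivative is not known to
    be continuous, so Green's formula is out of reach and bisection takes its place. Neighbourhoods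
    are squares throughout: they are the balls of the product structure on the plane, and with two
    points they contain the whole axis-parallel rectangle having these as opposite corners. Hence
    every path can be made of horizontal and vertical pieces, and every integral is a Riemann
    integral in one real variable.

    The curves of the hypothesis need not be smooth, so the bound avoids integrating along them. The
    1 in [B + 1] is the error allowed in the definition of the derivative at a single point z. This
    controls F w - F z only for w near z, with z itself as one end, and the partition of the curve
    has to be built so that every step has such a point as an end. *)

Lemma interval_induction (b : R) (S : R -> Prop) :
  0 <= b -> S 0 ->
  (forall t, 0 <= t <= b -> exists d, 0 < d /\
     forall s u, 0 <= s <= t -> t <= u <= b -> t - d < s -> u < t + d ->
       S s -> S u) ->
  S b.
Proof.
intros Hb S0 Hstep.
destruct (completeness (fun t => 0 <= t <= b /\ S t)) as [T [Tub Tlub]].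
- exists b; intros t [Ht _]; lra.
- exists 0; split; [lra|exact S0].
- assert (T0 : 0 <= T) by (apply Tub; split; [lra|exact S0]).
  assert (Tb : T <= b) by (apply Tlub; intros t [Ht _]; lra).
  destruct (Hstep T (conj T0 Tb)) as [d [Hd Hs]].
  assert (Hex : exists s, (0 <= s <= b /\ S s) /\ T - d < s).
  { apply NNPP; intro Hn.
    assert (T <= T - d); [|lra].
    apply Tlub; intros s Hs'.
    destruct (Rle_or_lt s (T - d)) as [H|H]; [exact H|].
    exfalso; apply Hn; exists s; auto. }
  destruct Hex as [s [[Hsb Ss] Hsd]].
  (* A point of [S] near the supremum [T] is carried across [T]. As nothing beyond [T] satisfies
     [S], the minimum must be [b]. *)
  assert (Hu : S (Rmin b (T + d / 2))).
  { apply (Hs s); auto.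
    - split; [lra|apply Tub; auto].
    - split; [apply Rmin_glb; lra|apply Rmin_l].
    - pose proof (Rmin_r b (T + d / 2)); lra. }
  assert (Hle : Rmin b (T + d / 2) <= T).
  { apply Tub; split; [|exact Hu].
    split; [apply Rmin_glb; lra|apply Rmin_l]. }
  revert Hu Hle; unfold Rmin; destruct (Rle_dec b (T + d / 2)); auto; intros; lra.
Qed.

Definition sq (c : C) (r : R) (z : C) : Prop :=
  Rabs (fst z - fst c) < r /\ Rabs (snd z - snd c) < r.

Lemma sq_center (c : C) (r : R) : 0 < r -> sq c r c.
Proof. intro Hr; unfold sq; rewrite !Rminus_diag, !Rabs_R0; auto. Qed.

Lemma sq_le (c : C) (r r' : R) (z : C) : r <= r' -> sq c r z -> sq c r' z.
Proof. unfold sq; lra. Qed.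

Lemma sq_sub (c : C) (r : R) (z : C) :
  sq c r z -> exists d, 0 < d /\ forall w, sq z d w -> sq c r w.
Proof.
unfold sq; intros [H1 H2].
exists (Rmin (r - Rabs (fst z - fst c)) (r - Rabs (snd z - snd c))); split.
- apply Rmin_pos; lra.
- intros w [W1 W2].
  pose proof (Rmin_l (r - Rabs (fst z - fst c)) (r - Rabs (snd z - snd c))).
  pose proof (Rmin_r (r - Rabs (fst z - fst c)) (r - Rabs (snd z - snd c))).
  pose proof (Rabs_triang (fst w - fst z) (fst z - fst c)).
  pose proof (Rabs_triang (snd w - snd z) (snd z - snd c)).
  replace (fst w - fst z + (fst z - fst c)) with (fst w - fst c) in * by ring.
  replace (snd w - snd z + (snd z - snd c)) with (snd w - snd c) in * by ring.
  lra.
Qed.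

Lemma open_sq (U : C -> Prop) :
  open U <-> forall z, U z -> exists d, 0 < d /\ forall w, sq z d w -> U w.
Proof.
split.
- intros HU z Uz; destruct (HU z Uz) as [d Hd].
  exists d; split; [apply cond_pos|intros w Hw; apply Hd, Hw].
- intros HU z Uz; destruct (HU z Uz) as [d [Hd Hw]].
  exists (mkposreal d Hd); intros w H; apply Hw, H.
Qed.

Lemma open_sq_set (c : C) (r : R) : open (sq c r).
Proof. apply open_sq; intros z Hz; apply (sq_sub c r z Hz). Qed.

Lemma continuous_on_sq (g : R -> C) (t e : R) :
  continuous_on unit_interval g -> unit_interval t -> 0 < e ->
  exists d, 0 < d /\
    forall s, unit_interval s -> Rabs (s - t) < d -> sq (g t) e (g s).
Proof.
intros Hg Ht He.
destruct (Hg t Ht (sq (g t) e)) as [d Hd].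
- exists (mkposreal e He); intros w H; exact H.
- exists d; split; [apply cond_pos|intros s Hs H; apply Hd; auto].
Qed.

Definition segment (a b : C) (t : R) : C :=
  (fst a + t * (fst b - fst a), snd a + t * (snd b - snd a)).

Lemma segment_0 (a b : C) : segment a b 0 = a.
Proof. destruct a, b; unfold segment; simpl; f_equal; ring. Qed.

Lemma segment_1 (a b : C) : segment a b 1 = b.
Proof. destruct a, b; unfold segment; simpl; f_equal; ring. Qed.

Lemma segment_continuous (a b : C) : continuous_on unit_interval (segment a b).
Proof.
intros t _ U [e HU].
set (K := Rabs (fst b - fst a) + Rabs (snd b - snd a) + 1).
assert (HK : 0 < K).
{ unfold K; pose proof (Rabs_pos (fst b - fst a));
  pose proof (Rabs_pos (snd b - snd a)); lra. }
exists (mkposreal (e / K) (Rdiv_lt_0_compat _ _ (cond_pos e) HK)).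
intros s Hs _; apply HU.
change (Rabs (s - t) < e / K) in Hs.
assert (Hlt : Rabs (s - t) * K < e).
{ apply (Rmult_lt_reg_r (/ K)); [apply Rinv_0_lt_compat, HK|].
  rewrite Rmult_assoc, Rinv_r, Rmult_1_r by lra; exact Hs. }
assert (Hc : forall x y, Rabs (y - x) <= K ->
  Rabs (x + s * (y - x) - (x + t * (y - x))) < e).
{ intros x y H.
  replace (x + s * (y - x) - (x + t * (y - x))) with ((s - t) * (y - x)) by ring.
  rewrite Rabs_mult; apply Rle_lt_trans with (2 := Hlt).
  apply Rmult_le_compat_l; [apply Rabs_pos|exact H]. }
pose proof (Rabs_pos (fst b - fst a)).
pose proof (Rabs_pos (snd b - snd a)).
split; apply Hc; unfold K; lra.
Qed.

Lemma sq_segment (c : C) (r : R) (a b : C) (t : R) :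
  sq c r a -> sq c r b -> unit_interval t -> sq c r (segment a b t).
Proof.
assert (Hc : forall x y z, Rabs (x - z) < r -> Rabs (y - z) < r ->
  0 <= t <= 1 -> Rabs (x + t * (y - x) - z) < r).
{ intros x y z Hx Hy Ht.
  apply Rabs_def2 in Hx; apply Rabs_def2 in Hy.
  destruct (Rle_or_lt x y); apply Rabs_def1; nra. }
intros [A1 A2] [B1 B2] Ht; split; simpl; apply Hc; auto.
Qed.

(** Near each t the path stays in whichever set contains [g t], so a value in [U] just before t
    excludes [V] there; interval induction propagates this. *)
Lemma path_clopen (g : R -> C) (U V : C -> Prop) (b : R) :
  continuous_on unit_interval g -> open U -> open V ->
  (forall z, ~ (U z /\ V z)) ->
  (forall t, unit_interval t -> U (g t) \/ V (g t)) ->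
  U (g 0) -> unit_interval b -> U (g b).
Proof.
intros Hg HU HV Hdis Hcov U0 Hb; unfold unit_interval in *.
apply (interval_induction b (fun t => U (g t))); [lra|exact U0|].
intros t Ht.
assert (Hnear : forall W, open W -> W (g t) -> exists d, 0 < d /\
  forall s, 0 <= s <= 1 -> Rabs (s - t) < d -> W (g s)).
{ intros W HW Wt; destruct (proj1 (open_sq W) HW _ Wt) as [e [He Hsq]].
  destruct (continuous_on_sq g t e) as [d [Hd H]]; auto.
  { unfold unit_interval; lra. }
  exists d; split; auto. }
destruct (Hcov t) as [Ut|Vt]; [lra| |].
- destruct (Hnear U HU Ut) as [d [Hd H]].
  exists d; split; auto; intros s u Hs Hu _ Hud _.
  apply H; [lra|apply Rabs_def1; lra].
- destruct (Hnear V HV Vt) as [d [Hd H]].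
  exists d; split; auto; intros s u Hs Hu Hsd _ Us.
  exfalso; apply (Hdis (g s)); split; auto.
  apply H; [lra|apply Rabs_def1; lra].
Qed.

Lemma plane_clopen (U V : C -> Prop) (a b : C) :
  open U -> open V -> (forall z, ~ (U z /\ V z)) -> (forall z, U z \/ V z) ->
  U a -> U b.
Proof.
intros HU HV Hdis Hcov Ua.
rewrite <- (segment_1 a b).
apply path_clopen with (V := V); auto; [apply segment_continuous| |].
- now rewrite segment_0.
- unfold unit_interval; lra.
Qed.

(** [A] cannot be split, and each point of the square is joined to the common point [z] by a segment
    inside the square, so everything lies on the side of [z]. *)
Lemma connected_union_sq (A : C -> Prop) (c : C) (r : R) (z : C) :
  connected A -> A z -> sq c r z -> connected (fun w => A w \/ sq c r w).
Proof.
intros HA Az Hz U V HU HV Hcov [u [Hu Uu]] [v [Hv Vv]].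
apply NNPP; intro Hn.
assert (Hside : forall U V : C -> Prop, open U -> open V ->
  (forall w, A w \/ sq c r w -> U w \/ V w) ->
  ~ (exists w, (A w \/ sq c r w) /\ U w /\ V w) ->
  U z -> forall w, A w \/ sq c r w -> U w).
{ clear - HA Az Hz; intros U V HU HV Hcov Hn Uz w [Aw|Sw].
  - destruct (Hcov w (or_introl Aw)) as [H|Vw]; auto.
    exfalso; apply Hn.
    destruct (HA U V HU HV) as [x [Ax Hx]]; eauto.
  - set (U' := fun w => U w /\ sq c r w); set (V' := fun w => V w /\ sq c r w).
    enough (U' w) by (unfold U' in *; tauto).
    rewrite <- (segment_1 z w).
    apply path_clopen with (V := V').
    + apply segment_continuous.
    + apply open_and; [exact HU|apply open_sq_set].
    + apply open_and; [exact HV|apply open_sq_set].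
    + unfold U', V'; intros x [[H1 H2] [H3 H4]]; apply Hn; exists x; auto.
    + intros t Ht; pose proof (sq_segment c r z w t Hz Sw Ht) as Hs.
      unfold U', V'; destruct (Hcov _ (or_intror Hs)); auto.
    + rewrite segment_0; split; auto.
    + unfold unit_interval; lra. }
destruct (Hcov z (or_introl Az)) as [Uz|Vz].
- apply Hn; exists v; split; auto; split; auto.
  apply (Hside U V); auto.
- apply Hn; exists u; split; auto; split; auto.
  apply (Hside V U); auto.
  + intros w Hw; destruct (Hcov w Hw); auto.
  + intros [w [H1 [H2 H3]]]; apply Hn; eauto.
Qed.

Lemma component_sq (A B : C -> Prop) (c : C) (r : R) (z : C) :
  is_connected_component A B -> (forall w, sq c r w -> A w) ->
  B z -> sq c r z -> forall w, sq c r w -> B w.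
Proof.
intros [_ [HBA [HB Hmax]]] HA Bz Hz w Hw.
apply (Hmax (fun w => B w \/ sq c r w)); auto.
- intros x [H|H]; auto.
- apply connected_union_sq with z; auto.
Qed.

Lemma open_component (A B : C -> Prop) :
  open A -> is_connected_component A B -> open B.
Proof.
intros HA HB; apply open_sq; intros z Bz.
destruct (proj1 (open_sq A) HA z) as [d [Hd H]]; [apply HB, Bz|].
exists d; split; auto.
apply (component_sq A B z d z); auto; apply sq_center; auto.
Qed.

(** Compactness of the curve, by interval induction on its initial arcs: a short arc around each
    parameter misses some square at [z], and two such radii combine into their minimum. *)
Lemma Jordan_curve_compl_open (J : C -> Prop) :
  is_Jordan_curve J -> open (fun z => ~ J z).
Proof.
intros [g [Hg [_ [_ HJ]]]]; apply open_sq; intros z Hz.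
assert (Hloc : forall t, 0 <= t <= 1 -> exists e d, 0 < e /\ 0 < d /\
  forall s, 0 <= s <= 1 -> Rabs (s - t) < d -> ~ sq z e (g s)).
{ intros t Ht.
  set (m := Rmax (Rabs (fst (g t) - fst z)) (Rabs (snd (g t) - snd z))).
  assert (Hm : 0 < m).
  { apply Rnot_le_lt; intro Hm; apply Hz, HJ; exists t; split; auto.
    pose proof (Rmax_l (Rabs (fst (g t) - fst z)) (Rabs (snd (g t) - snd z))).
    pose proof (Rmax_r (Rabs (fst (g t) - fst z)) (Rabs (snd (g t) - snd z))).
    pose proof (Rabs_pos (fst (g t) - fst z)).
    pose proof (Rabs_pos (snd (g t) - snd z)).
    apply injective_projections; apply Rminus_diag_uniq; apply NNPP;
      intro Hn; apply Rabs_pos_lt in Hn; unfold m in Hm; lra. }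
  destruct (continuous_on_sq g t (m / 2)) as [d [Hd H]]; auto; [lra|].
  exists (m / 2), d; split; [lra|split; [exact Hd|]].
  intros s Hs Hst [Z1 Z2]; destruct (H s Hs Hst) as [G1 G2].
  assert (m < m); [|lra].
  apply Rmax_lub_lt.
  - replace (fst (g t) - fst z) with
      (fst (g s) - fst z - (fst (g s) - fst (g t))) by ring.
    apply Rle_lt_trans with (1 := Rabs_triang _ _); rewrite Rabs_Ropp; lra.
  - replace (snd (g t) - snd z) with
      (snd (g s) - snd z - (snd (g s) - snd (g t))) by ring.
    apply Rle_lt_trans with (1 := Rabs_triang _ _); rewrite Rabs_Ropp; lra. }
assert (H : exists e, 0 < e /\ forall s, 0 <= s <= 1 -> ~ sq z e (g s)).
{ apply (interval_induction 1 (fun t => exists e, 0 < e /\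
    forall s, 0 <= s <= t -> ~ sq z e (g s))); [lra| |].
  - destruct (Hloc 0) as [e [d [He [Hd H]]]]; [lra|].
    exists e; split; auto; intros s Hs; apply H; [lra|].
    replace (s - 0) with 0 by lra; rewrite Rabs_R0; auto.
  - intros t Ht; destruct (Hloc t Ht) as [e [d [He [Hd H]]]].
    exists d; split; auto; intros s u Hs Hu Hsd Hud [e' [He' H']].
    exists (Rmin e e'); split; [apply Rmin_pos; auto|].
    intros x Hx Hsq; destruct (Rle_or_lt x s) as [Hxs|Hxs].
    + apply (H' x); [lra|apply sq_le with (2 := Hsq), Rmin_r].
    + apply (H x); [lra|apply Rabs_def1; lra|apply sq_le with (2 := Hsq), Rmin_l]. }
destruct H as [e [He H]]; exists e; split; auto.
intros w Hw Jw; apply HJ in Jw; destruct Jw as [t [Ht <-]].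
apply (H t Ht Hw).
Qed.

(* Connectedness of A; U and V are disjoint in the whole plane, which loses nothing
   when A is closed. *)
Definition clopen_rigid (A : C -> Prop) : Prop :=
  forall U V : C -> Prop, open U -> open V -> (forall z, ~ (U z /\ V z)) ->
    (forall z, A z -> U z \/ V z) ->
    (exists z, A z /\ U z) -> forall z, A z -> U z.

Lemma Jordan_curve_clopen (J : C -> Prop) : is_Jordan_curve J -> clopen_rigid J.
Proof.
intros [g [Hg [_ [_ HJ]]]].
assert (H0 : forall U V : C -> Prop, open U -> open V ->
  (forall z, ~ (U z /\ V z)) -> (forall z, J z -> U z \/ V z) ->
  U (g 0) -> forall z, J z -> U z).
{ intros U V HU HV Hdis Hcov U0 z Jz.
  apply HJ in Jz; destruct Jz as [t [Ht <-]].
  apply path_clopen with (V := V); auto.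
  intros s Hs; apply Hcov, HJ; eauto. }
intros U V HU HV Hdis Hcov [z [Jz Uz]] w Jw.
destruct (Hcov (g 0)) as [U0|V0].
- apply HJ; exists 0; split; auto; unfold unit_interval; lra.
- apply (H0 U V); auto.
- exfalso; apply (Hdis z); split; auto.
  apply (H0 V U); auto.
  + intros x [H1 H2]; apply (Hdis x); auto.
  + intros x Jx; destruct (Hcov x Jx); auto.
Qed.

(** Instance for the plane of a classical fact: in a connected space, deleting a component of the
    complement of a connected set leaves a connected set. *)
Lemma component_compl_clopen (J B : C -> Prop) :
  (exists z, J z) -> open (fun z => ~ J z) -> clopen_rigid J ->
  is_connected_component (fun z => ~ J z) B -> clopen_rigid (fun z => ~ B z).
Proof.
intros [j Jj] HJo HJ HB.
assert (HBJ : forall z, J z -> ~ B z).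
{ intros z Jz Bz; destruct HB as [_ [H _]]; exact (H z Bz Jz). }
(* If J lies in U, the part of the complement of B inside V is open and closed in
   the plane. *)
assert (Hside : forall U V : C -> Prop, open U -> open V ->
  (forall z, ~ (U z /\ V z)) -> (forall z, ~ B z -> U z \/ V z) ->
  U j -> forall z, ~ B z -> U z).
{ intros U V HU HV Hdis Hcov Uj.
  assert (HJU : forall z, J z -> U z).
  { apply (HJ U V); auto; exists j; auto. }
  apply NNPP; intro Hn; apply not_all_ex_not in Hn; destruct Hn as [p Hp].
  apply imply_to_and in Hp; destruct Hp as [Bp Up].
  assert (Vp : V p) by (destruct (Hcov p Bp); tauto).
  assert (Hj : ~ B j /\ V j).
  { apply (plane_clopen (fun z => ~ B z /\ V z) (fun z => B z \/ U z) p).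
    - apply open_sq; intros z [Bz Vz].
      assert (Jz : ~ J z) by (intro Jz; apply (Hdis z); auto).
      destruct (proj1 (open_sq _) HJo z Jz) as [d [Hd Hdj]].
      destruct (proj1 (open_sq _) HV z Vz) as [e [He Hev]].
      exists (Rmin d e); split; [apply Rmin_pos; auto|].
      intros w Hw; split.
      (* A square missing [J] lies in a single component, so it cannot contain both [z], outside
         [B], and a point of [B]. *)
      + intro Bw; apply Bz.
        apply (component_sq _ B z d w HB Hdj Bw).
        * apply sq_le with (2 := Hw), Rmin_l.
        * apply sq_center; auto.
      + apply Hev, sq_le with (2 := Hw), Rmin_r.
    - apply open_or; [apply (open_component _ B HJo HB)|exact HU].
    - intros z [[H1 H2] [H3|H3]]; [tauto|apply (Hdis z); auto].
    - intro z; destruct (classic (B z)) as [Bz|Bz]; [auto|].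
      destruct (Hcov z Bz); auto.
    - auto. }
  apply (Hdis j); tauto. }
intros U V HU HV Hdis Hcov [z [Bz Uz]] w Bw.
destruct (Hcov j (HBJ j Jj)) as [Uj|Vj].
- apply (Hside U V); auto.
- exfalso; apply (Hdis z); split; auto.
  apply (Hside V U); auto.
  + intros x [H1 H2]; apply (Hdis x); auto.
  + intros x Hx; destruct (Hcov x Hx); auto.
Qed.

Lemma Jordan_domain_open (Om : C -> Prop) : Jordan_domain Om -> open Om.
Proof.
intros [J [HJ [HO _]]].
apply (open_component (fun z => ~ J z)); auto; apply Jordan_curve_compl_open; auto.
Qed.

Lemma Jordan_domain_compl_clopen (Om : C -> Prop) :
  Jordan_domain Om -> clopen_rigid (fun z => ~ Om z).
Proof.
intros [J [HJ [HO _]]]; apply (component_compl_clopen J); auto.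
- destruct HJ as [g [_ [_ [_ H]]]]; exists (g 0); apply H.
  exists 0; split; auto; unfold unit_interval; lra.
- apply Jordan_curve_compl_open; auto.
- apply Jordan_curve_clopen; auto.
Qed.

(** * Goursat's theorem for closed 1-forms *)

(* The coefficients of P dx + Q dy are differentiable at z with symmetric Jacobian
   matrix (p, q; q, r); no continuity of the derivatives is asked. *)
Definition closed_form_at (P Q : R -> R -> R) (z : C) : Prop :=
  exists p q r : R, forall e, 0 < e -> exists d, 0 < d /\
    forall u v, sq z d (u, v) ->
      Rabs (P u v - P (fst z) (snd z) - (p * (u - fst z) + q * (v - snd z)))
        <= e * (Rabs (u - fst z) + Rabs (v - snd z)) /\
      Rabs (Q u v - Q (fst z) (snd z) - (q * (u - fst z) + r * (v - snd z)))
        <= e * (Rabs (u - fst z) + Rabs (v - snd z)).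

Definition hint (P : R -> R -> R) (y x x' : R) : R := RInt (fun t => P t y) x x'.
Definition vint (Q : R -> R -> R) (x y y' : R) : R := RInt (fun t => Q x t) y y'.

Definition circulation (P Q : R -> R -> R) (x y x' y' : R) : R :=
  hint P y x x' + vint Q x' y y' - hint P y' x x' - vint Q x y y'.

Lemma closed_form_modulus (P Q : R -> R -> R) (z : C) (e : R) :
  closed_form_at P Q z -> 0 < e -> exists d, 0 < d /\
    forall u v, sq z d (u, v) ->
      Rabs (P u v - P (fst z) (snd z)) < e /\
      Rabs (Q u v - Q (fst z) (snd z)) < e.
Proof.
intros [p [q [r H]]] He.
destruct (H 1 Rlt_0_1) as [d [Hd Hpq]].
(* [K] dominates [|p| + |q| + 2] and [|q| + |r| + 2]; the 2 absorbs the remainder, which is at most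
   the sum of the two increments. *)
set (K := Rabs p + 2 * Rabs q + Rabs r + 2).
pose proof (Rabs_pos p); pose proof (Rabs_pos q); pose proof (Rabs_pos r).
assert (HK : 0 < K) by (unfold K; lra).
assert (HeK : 0 < e / K) by (apply Rdiv_lt_0_compat; auto).
assert (HKe : K * (e / K) = e) by (field; lra).
exists (Rmin d (e / K)); split; [apply Rmin_pos; auto|].
intros u v Huv.
destruct (Hpq u v) as [HP HQ]; [apply sq_le with (2 := Huv), Rmin_l|].
apply (sq_le _ _ (e / K)) in Huv; [|apply Rmin_r].
destruct Huv as [Hu Hv]; simpl in Hu, Hv.
set (U := Rabs (u - fst z)) in *; set (V := Rabs (v - snd z)) in *.
assert (Hlin : forall a b, Rabs a + Rabs b + 2 <= K -> forall w,
  Rabs (w - (a * (u - fst z) + b * (v - snd z))) <= 1 * (U + V) -> Rabs w < e).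
{ intros a b Hab w Hw.
  assert (H3 : Rabs (a * (u - fst z) + b * (v - snd z)) <= Rabs a * U + Rabs b * V).
  { apply Rle_trans with (1 := Rabs_triang _ _).
    rewrite !Rabs_mult; apply Rle_refl. }
  assert (Rabs w <= 1 * (U + V) + (Rabs a * U + Rabs b * V)).
  { replace w with (w - (a * (u - fst z) + b * (v - snd z)) +
      (a * (u - fst z) + b * (v - snd z))) at 1 by ring.
    apply Rle_trans with (1 := Rabs_triang _ _); lra. }
  pose proof (Rabs_pos a); pose proof (Rabs_pos b).
  assert (0 <= U) by apply Rabs_pos; assert (0 <= V) by apply Rabs_pos.
  nra. }
split; [apply (Hlin p q)|apply (Hlin q r)]; auto; unfold K; lra.
Qed.

Section ClosedForm.

Variables P Q : R -> R -> R.

Definition form_closed_on (A : C -> Prop) : Prop :=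
  forall z, A z -> closed_form_at P Q z.

Lemma hint_ex (y x x' : R) :
  (forall t, Rmin x x' <= t <= Rmax x x' -> closed_form_at P Q (t, y)) ->
  ex_RInt (fun t => P t y) x x'.
Proof.
intro H; apply (ex_RInt_continuous (V := R_CompleteNormedModule)); intros t Ht.
intros U [e HU].
destruct (closed_form_modulus P Q (t, y) e (H t Ht) (cond_pos e)) as [d [Hd Hm]].
exists (mkposreal d Hd); intros s Hs; apply HU.
apply (Hm s y); split; simpl; [exact Hs|].
rewrite Rminus_diag, Rabs_R0; auto.
Qed.

Lemma vint_ex (x y y' : R) :
  (forall t, Rmin y y' <= t <= Rmax y y' -> closed_form_at P Q (x, t)) ->
  ex_RInt (fun t => Q x t) y y'.
Proof.
intro H; apply (ex_RInt_continuous (V := R_CompleteNormedModule)); intros t Ht.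
intros U [e HU].
destruct (closed_form_modulus P Q (x, t) e (H t Ht) (cond_pos e)) as [d [Hd Hm]].
exists (mkposreal d Hd); intros s Hs; apply HU.
apply (Hm x s); split; simpl; [|exact Hs].
rewrite Rminus_diag, Rabs_R0; auto.
Qed.

Lemma RInt_near_const (g : R -> R) (a b c e : R) :
  a <= b -> ex_RInt g a b -> (forall t, a <= t <= b -> Rabs (g t - c) <= e) ->
  Rabs (RInt g a b - c * (b - a)) <= e * (b - a).
Proof.
intros Hab Hg H.
replace (RInt g a b - c * (b - a)) with (RInt (fun t => g t - c) a b).
- rewrite (Rmult_comm e); apply abs_RInt_le_const; auto.
  apply (ex_RInt_minus (V := R_NormedModule)); auto; apply ex_RInt_const.
- rewrite (RInt_minus (V := R_CompleteNormedModule) g (fun _ => c)), RInt_const; auto.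
  + change (RInt g a b - (b - a) * c = RInt g a b - c * (b - a)); ring.
  + apply ex_RInt_const.
Qed.

Definition rect (x y x' y' : R) (z : C) : Prop :=
  x <= fst z <= x' /\ y <= snd z <= y'.

Lemma hint_ex_rect (x y x' y' u v s : R) :
  form_closed_on (rect x y x' y') -> x <= u -> u <= v -> v <= x' -> y <= s <= y' ->
  ex_RInt (fun t => P t s) u v.
Proof.
intros H H1 H2 H3 H4; apply hint_ex; intros t.
rewrite Rmin_left, Rmax_right by auto; intro Ht; apply H; split; simpl; lra.
Qed.

Lemma vint_ex_rect (x y x' y' u v s : R) :
  form_closed_on (rect x y x' y') -> y <= u -> u <= v -> v <= y' -> x <= s <= x' ->
  ex_RInt (fun t => Q s t) u v.
Proof.
intros H H1 H2 H3 H4; apply vint_ex; intros t.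
rewrite Rmin_left, Rmax_right by auto; intro Ht; apply H; split; simpl; lra.
Qed.

Lemma hint_Chasles (y a b c : R) :
  ex_RInt (fun t => P t y) a b -> ex_RInt (fun t => P t y) b c ->
  hint P y a c = hint P y a b + hint P y b c.
Proof. intros H1 H2; symmetry; apply (RInt_Chasles (V := R_CompleteNormedModule)); auto. Qed.

Lemma vint_Chasles (x a b c : R) :
  ex_RInt (fun t => Q x t) a b -> ex_RInt (fun t => Q x t) b c ->
  vint Q x a c = vint Q x a b + vint Q x b c.
Proof. intros H1 H2; symmetry; apply (RInt_Chasles (V := R_CompleteNormedModule)); auto. Qed.

Lemma circulation_quarters (x y x' y' u v : R) :
  form_closed_on (rect x y x' y') -> x <= u <= x' -> y <= v <= y' ->
  circulation P Q x y x' y' =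
  circulation P Q x y u v + circulation P Q u y x' v +
  circulation P Q x v u y' + circulation P Q u v x' y'.
Proof.
intros H Hu Hv; unfold circulation.
assert (Hh : forall s, y <= s <= y' ->
  hint P s x x' = hint P s x u + hint P s u x').
{ intros s Hs; apply hint_Chasles; apply (hint_ex_rect x y x' y'); auto; lra. }
assert (Hw : forall s, x <= s <= x' ->
  vint Q s y y' = vint Q s y v + vint Q s v y').
{ intros s Hs; apply vint_Chasles; apply (vint_ex_rect x y x' y'); auto; lra. }
rewrite (Hh y), (Hh y'), (Hw x), (Hw x') by lra; ring.
Qed.

(* The linear part of the form contributes - q a b along the horizontal sides and
   q a b along the vertical ones. *)
Lemma circulation_small (z : C) (e : R) :
  closed_form_at P Q z -> 0 < e -> exists d, 0 < d /\
    forall x y a b, 0 <= a < d -> 0 <= b < d ->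
      form_closed_on (rect x y (x + a) (y + b)) ->
      rect x y (x + a) (y + b) z ->
      Rabs (circulation P Q x y (x + a) (y + b)) <= e * (a + b) ^ 2.
Proof.
intros [p [q [r Hz]]] He.
(* Opposite sides are paired, so two remainders of size [(e / 2) * (a + b)] add up; integration over
   lengths [a] and [b] then gives [e * (a + b) ^ 2]. *)
destruct (Hz (e / 2)) as [d [Hd Hpq]]; [lra|].
exists d; split; auto; intros x y a b Ha Hb HR [Hx Hy].
assert (Hin : forall u v, x <= u <= x + a -> y <= v <= y + b ->
  sq z d (u, v) /\ Rabs (u - fst z) + Rabs (v - snd z) <= a + b).
{ intros u v Hu Hv.
  assert (Rabs (u - fst z) <= a) by (apply Rabs_le; lra).
  assert (Rabs (v - snd z) <= b) by (apply Rabs_le; lra).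
  unfold sq; simpl; lra. }
assert (HP : forall t, x <= t <= x + a ->
  Rabs (P t y - P t (y + b) - - (q * b)) <= e * (a + b)).
{ intros t Ht.
  destruct (Hin t y) as [I1 J1]; [lra|lra|].
  destruct (Hin t (y + b)) as [I2 J2]; [lra|lra|].
  destruct (Hpq _ _ I1) as [K1 _]; destruct (Hpq _ _ I2) as [K2 _].
  replace (P t y - P t (y + b) - - (q * b)) with
    ((P t y - P (fst z) (snd z) - (p * (t - fst z) + q * (y - snd z))) -
     (P t (y + b) - P (fst z) (snd z) - (p * (t - fst z) + q * (y + b - snd z))))
    by ring.
  apply Rle_trans with (1 := Rabs_triang _ _); rewrite Rabs_Ropp; nra. }
assert (HQ : forall t, y <= t <= y + b ->
  Rabs (Q (x + a) t - Q x t - q * a) <= e * (a + b)).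
{ intros t Ht.
  destruct (Hin x t) as [I1 J1]; [lra|lra|].
  destruct (Hin (x + a) t) as [I2 J2]; [lra|lra|].
  destruct (Hpq _ _ I1) as [_ K1]; destruct (Hpq _ _ I2) as [_ K2].
  replace (Q (x + a) t - Q x t - q * a) with
    ((Q (x + a) t - Q (fst z) (snd z) - (q * (x + a - fst z) + r * (t - snd z))) -
     (Q x t - Q (fst z) (snd z) - (q * (x - fst z) + r * (t - snd z))))
    by ring.
  apply Rle_trans with (1 := Rabs_triang _ _); rewrite Rabs_Ropp; nra. }
assert (Eh : forall s, y <= s <= y + b -> ex_RInt (fun t => P t s) x (x + a)).
{ intros s Hs; apply (hint_ex_rect x y (x + a) (y + b)); auto; lra. }
assert (Ev : forall s, x <= s <= x + a -> ex_RInt (fun t => Q s t) y (y + b)).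
{ intros s Hs; apply (vint_ex_rect x y (x + a) (y + b)); auto; lra. }
assert (Eh1 := Eh y ltac:(lra)); assert (Eh2 := Eh (y + b) ltac:(lra)).
assert (Ev1 := Ev x ltac:(lra)); assert (Ev2 := Ev (x + a) ltac:(lra)).
apply (RInt_near_const (fun t => P t y - P t (y + b))) in HP;
  [|lra|apply (ex_RInt_minus (V := R_NormedModule)); auto].
apply (RInt_near_const (fun t => Q (x + a) t - Q x t)) in HQ;
  [|lra|apply (ex_RInt_minus (V := R_NormedModule)); auto].
rewrite (RInt_minus (V := R_CompleteNormedModule) (fun t => P t y)) in HP by auto.
rewrite (RInt_minus (V := R_CompleteNormedModule) (fun t => Q (x + a) t)) in HQ by auto.
change minus with Rminus in HP, HQ.
unfold circulation, hint, vint.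
set (A1 := RInt (fun t => P t y) x (x + a)) in *.
set (A2 := RInt (fun t => P t (y + b)) x (x + a)) in *.
set (B1 := RInt (fun t => Q x t) y (y + b)) in *.
set (B2 := RInt (fun t => Q (x + a) t) y (y + b)) in *.
change (Rabs (A1 - A2 - - (q * b) * (x + a - x)) <= e * (a + b) * (x + a - x)) in HP.
change (Rabs (B2 - B1 - q * a * (y + b - y)) <= e * (a + b) * (y + b - y)) in HQ.
replace (A1 + B2 - A2 - B1) with
  (A1 - A2 - - (q * b) * (x + a - x) + (B2 - B1 - q * a * (y + b - y))) by ring.
apply Rle_trans with (1 := Rabs_triang _ _); lra.
Qed.

End ClosedForm.

(** Nested rectangles for an arbitrary predicate: if [G] failed, some quarter would fail at every
    stage, and the common point of the shrinking rectangles would contradict the local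
    hypothesis. *)
Lemma bisection (G : R -> R -> R -> R -> Prop) (x0 y0 a0 b0 : R) :
  0 <= a0 -> 0 <= b0 ->
  (forall x y a b, 0 <= a -> 0 <= b ->
    x0 <= x -> x + 2 * a <= x0 + a0 -> y0 <= y -> y + 2 * b <= y0 + b0 ->
    G x y a b -> G (x + a) y a b -> G x (y + b) a b -> G (x + a) (y + b) a b ->
    G x y (2 * a) (2 * b)) ->
  (forall z, rect x0 y0 (x0 + a0) (y0 + b0) z -> exists d, 0 < d /\
    forall x y a b, 0 <= a < d -> 0 <= b < d ->
    x0 <= x -> x + a <= x0 + a0 -> y0 <= y -> y + b <= y0 + b0 ->
    rect x y (x + a) (y + b) z -> G x y a b) ->
  G x0 y0 a0 b0.
Proof.
intros Ha0 Hb0 Hquad Hloc; apply NNPP; intro Hbad.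
set (a := fun n : nat => a0 / 2 ^ n); set (b := fun n : nat => b0 / 2 ^ n).
assert (H2 : forall n, 0 < 2 ^ n) by (intro; apply pow_lt; lra).
assert (Ha : forall n, 0 <= a n /\ a n = 2 * a (S n)).
{ intro n; specialize (H2 n); unfold a; simpl; split; [|field; lra].
  apply Rdiv_le_0_compat; auto. }
assert (Hb : forall n, 0 <= b n /\ b n = 2 * b (S n)).
{ intro n; specialize (H2 n); unfold b; simpl; split; [|field; lra].
  apply Rdiv_le_0_compat; auto. }
set (Bad := fun (n : nat) (z : C) =>
  x0 <= fst z /\ fst z + a n <= x0 + a0 /\ y0 <= snd z /\ snd z + b n <= y0 + b0 /\
  ~ G (fst z) (snd z) (a n) (b n)).
(* Badness is assumed under the existential, so that the choice function [next] is total. *)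
assert (Hnext : forall n z, exists w, Bad n z ->
  Bad (S n) w /\ fst z <= fst w /\ fst w + a (S n) <= fst z + a n /\
  snd z <= snd w /\ snd w + b (S n) <= snd z + b n).
{ intros n [x y]; destruct (classic (Bad n (x, y))) as [HB|HB];
    [|exists (x, y); tauto].
  destruct HB as [X1 [X2 [Y1 [Y2 HG]]]]; simpl in *.
  destruct (Ha n) as [An En]; destruct (Hb n) as [Bn Fn].
  pose proof (Ha (S n)) as [An' _]; pose proof (Hb (S n)) as [Bn' _].
  apply NNPP; intro Hn; apply HG; rewrite En, Fn.
  apply Hquad; try lra; apply NNPP; intro HG'; apply Hn.
  - exists (x, y); intros _; unfold Bad; simpl; repeat split; auto; lra.
  - exists (x + a (S n), y); intros _; unfold Bad; simpl; repeat split; auto; lra.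
  - exists (x, y + b (S n)); intros _; unfold Bad; simpl; repeat split; auto; lra.
  - exists (x + a (S n), y + b (S n)); intros _; unfold Bad; simpl;
      repeat split; auto; lra. }
set (next := fun n z => proj1_sig (constructive_indefinite_description _ (Hnext n z))).
assert (Hnx : forall n z, Bad n z ->
  Bad (S n) (next n z) /\ fst z <= fst (next n z) /\
  fst (next n z) + a (S n) <= fst z + a n /\
  snd z <= snd (next n z) /\ snd (next n z) + b (S n) <= snd z + b n).
{ intros n z; exact (proj2_sig (constructive_indefinite_description _ (Hnext n z))). }
set (s := fix s n := match n with O => (x0, y0) : C | S m => next m (s m) end).
assert (HsB : forall n, Bad n (s n)).
{ induction n as [|n IH]; [|apply Hnx, IH].
  unfold Bad, a, b; simpl; rewrite !Rdiv_1_r; repeat split; auto; lra. }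
assert (Hmon : forall n k, fst (s n) <= fst (s (n + k)%nat) /\
  fst (s (n + k)%nat) + a (n + k)%nat <= fst (s n) + a n /\
  snd (s n) <= snd (s (n + k)%nat) /\
  snd (s (n + k)%nat) + b (n + k)%nat <= snd (s n) + b n).
{ intros n; induction k as [|k IH].
  - rewrite Nat.add_0_r; lra.
  - rewrite Nat.add_succ_r; simpl s.
    destruct (Hnx _ _ (HsB (n + k)%nat)) as [_ H]; lra. }
(* Every lower left corner is below every upper right one, so the suprema of the lower left
   coordinates give a point of all the rectangles. *)
assert (Hcross : forall n m, fst (s m) <= fst (s n) + a n /\ snd (s m) <= snd (s n) + b n).
{ intros n m; destruct (Nat.le_ge_cases n m) as [H|H].
  - replace m with (n + (m - n))%nat by lia.
    pose proof (Hmon n (m - n)%nat).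
    pose proof (Ha (n + (m - n))%nat); pose proof (Hb (n + (m - n))%nat); lra.
  - replace n with (m + (n - m))%nat by lia.
    pose proof (Hmon m (n - m)%nat).
    pose proof (Ha (m + (n - m))%nat); pose proof (Hb (m + (n - m))%nat); lra. }
destruct (completeness (fun t => exists n, t = fst (s n))) as [X [Xub Xlub]].
{ exists (fst (s O) + a O); intros t [n ->]; apply Hcross. }
{ exists (fst (s O)); exists O; auto. }
destruct (completeness (fun t => exists n, t = snd (s n))) as [Y [Yub Ylub]].
{ exists (snd (s O) + b O); intros t [n ->]; apply Hcross. }
{ exists (snd (s O)); exists O; auto. }
assert (Hlim : forall n, rect (fst (s n)) (snd (s n)) (fst (s n) + a n) (snd (s n) + b n) (X, Y)).
{ intro n; split; simpl; split.
  - apply Xub; eauto.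
  - apply Xlub; intros t [m ->]; apply Hcross.
  - apply Yub; eauto.
  - apply Ylub; intros t [m ->]; apply Hcross. }
destruct (Hloc (X, Y)) as [d [Hd HG]].
{ pose proof (Hlim O) as H; unfold a, b in H; simpl in H; rewrite !Rdiv_1_r in H; auto. }
(* The 1 keeps the divisor positive for a degenerate rectangle; both sides of the n-th rectangle
   become less than [d]. *)
destruct (pow_lt_1_zero (/ 2) ltac:(rewrite Rabs_pos_eq; lra) (d / (a0 + b0 + 1)))
  as [n Hn].
{ apply Rdiv_lt_0_compat; lra. }
specialize (Hn n (Nat.le_refl n)).
rewrite pow_inv, Rabs_pos_eq in Hn by (left; apply Rinv_0_lt_compat; auto).
assert (Hsmall : (a0 + b0 + 1) / 2 ^ n < d).
{ replace d with ((a0 + b0 + 1) * (d / (a0 + b0 + 1))) by (field; lra).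
  apply Rmult_lt_compat_l; [lra|exact Hn]. }
assert (Hinv : 0 < / 2 ^ n) by (apply Rinv_0_lt_compat; auto).
destruct (HsB n) as [X1 [X2 [Y1 [Y2 HGn]]]]; apply HGn.
apply HG; auto; unfold a, b, Rdiv in *; split; nra.
Qed.

Theorem Goursat (P Q : R -> R -> R) (x y x' y' : R) :
  x <= x' -> y <= y' -> form_closed_on P Q (rect x y x' y') ->
  circulation P Q x y x' y' = 0.
Proof.
intros Hx Hy HR.
set (a := x' - x); set (b := y' - y).
assert (H : forall e, 0 < e -> Rabs (circulation P Q x y (x + a) (y + b)) <= e * (a + b) ^ 2).
{ intros e He.
  (* The bound is quadratic in the side lengths, so the bounds on four quarters add up exactly to
     the bound on the whole. *)
  apply (bisection (fun x y a b => Rabs (circulation P Q x y (x + a) (y + b)) <= e * (a + b) ^ 2));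
    try (unfold a, b; lra).
  - intros u v c d Hc Hd U1 U2 V1 V2 G1 G2 G3 G4.
    rewrite (circulation_quarters P Q u v (u + 2 * c) (v + 2 * d) (u + c) (v + d));
      [|intros z [Hz1 Hz2]; apply HR; unfold a, b in *; split; lra|lra|lra].
    replace (u + 2 * c) with (u + c + c) by ring.
    replace (v + 2 * d) with (v + d + d) by ring.
    replace (e * (2 * c + 2 * d) ^ 2) with
      (e * (c + d) ^ 2 + e * (c + d) ^ 2 + e * (c + d) ^ 2 + e * (c + d) ^ 2) by ring.
    apply Rle_trans with (1 := Rabs_triang _ _); apply Rplus_le_compat; auto.
    apply Rle_trans with (1 := Rabs_triang _ _); apply Rplus_le_compat; auto.
    apply Rle_trans with (1 := Rabs_triang _ _); apply Rplus_le_compat; auto.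
  - intros z Hz.
    destruct (circulation_small P Q z e) as [d [Hd H]]; auto.
    { apply HR; unfold rect, a, b in *; lra. }
    exists d; split; auto; intros u v c f Hc Hf U1 U2 V1 V2 Hin.
    apply H; auto; intros w [W1 W2]; apply HR; unfold a, b in *; split; lra. }
replace x' with (x + a) by (unfold a; ring).
replace y' with (y + b) by (unfold b; ring).
apply NNPP; intro Hn; apply Rabs_pos_lt in Hn.
set (E := Rabs (circulation P Q x y (x + a) (y + b))) in *.
assert (HK : 0 < (a + b) ^ 2 + 1) by (pose proof (pow2_ge_0 (a + b)); lra).
(* With this error the bound reads [E <= E - E / ((a + b) ^ 2 + 1)], absurd for positive [E]. *)
specialize (H (E / ((a + b) ^ 2 + 1)) (Rdiv_lt_0_compat _ _ Hn HK)).
replace (E / ((a + b) ^ 2 + 1) * (a + b) ^ 2) with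
  (E - E / ((a + b) ^ 2 + 1)) in H by (field; lra).
pose proof (Rdiv_lt_0_compat _ _ Hn HK); lra.
Qed.

(** * Integration along L-shaped paths *)

Section Lpath.

Variables P Q : R -> R -> R.

Definition lint (a b : C) : R :=
  hint P (snd a) (fst a) (fst b) + vint Q (fst b) (snd a) (snd b).

Lemma rect_sq (c : C) (r : R) (a b z : C) :
  sq c r a -> sq c r b ->
  Rmin (fst a) (fst b) <= fst z <= Rmax (fst a) (fst b) ->
  Rmin (snd a) (snd b) <= snd z <= Rmax (snd a) (snd b) -> sq c r z.
Proof.
unfold sq; intros [A1 A2] [B1 B2] Hx Hy.
apply Rabs_def2 in A1; apply Rabs_def2 in A2.
apply Rabs_def2 in B1; apply Rabs_def2 in B2.
revert Hx Hy; unfold Rmin, Rmax.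
destruct (Rle_dec (fst a) (fst b)), (Rle_dec (snd a) (snd b));
  intros; split; apply Rabs_def1; lra.
Qed.

Lemma hint_ex_sq (c : C) (r : R) (s u v : R) :
  form_closed_on P Q (sq c r) -> sq c r (u, s) -> sq c r (v, s) ->
  ex_RInt (fun t => P t s) u v.
Proof.
intros H Hu Hv; apply (hint_ex P Q); intros t Ht; apply H.
apply (rect_sq c r (u, s) (v, s)); auto; simpl.
rewrite Rmin_left, Rmax_left; lra.
Qed.

Lemma vint_ex_sq (c : C) (r : R) (s u v : R) :
  form_closed_on P Q (sq c r) -> sq c r (s, u) -> sq c r (s, v) ->
  ex_RInt (fun t => Q s t) u v.
Proof.
intros H Hu Hv; apply (vint_ex P Q); intros t Ht; apply H.
apply (rect_sq c r (s, u) (s, v)); auto; simpl.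
rewrite Rmin_left, Rmax_left; lra.
Qed.

Lemma hint_swap (y a b : R) :
  ex_RInt (fun t => P t y) b a -> hint P y a b = - hint P y b a.
Proof. intro H; symmetry; apply (opp_RInt_swap (V := R_CompleteNormedModule)), H. Qed.

Lemma vint_swap (x a b : R) :
  ex_RInt (fun t => Q x t) b a -> vint Q x a b = - vint Q x b a.
Proof. intro H; symmetry; apply (opp_RInt_swap (V := R_CompleteNormedModule)), H. Qed.

(** The corners come in any order; reversing an integral changes its sign, which reduces the four
    cases to the sorted one. *)
Lemma circulation_sq (c : C) (r : R) (a b : C) :
  form_closed_on P Q (sq c r) -> sq c r a -> sq c r b ->
  circulation P Q (fst a) (snd a) (fst b) (snd b) = 0.
Proof.
intros H Ha Hb; destruct a as [x y]; destruct b as [x' y']; simpl.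
assert (Hz : forall u v, Rmin x x' <= u <= Rmax x x' -> Rmin y y' <= v <= Rmax y y' ->
  sq c r (u, v)).
{ intros u v Hu Hv; apply (rect_sq c r (x, y) (x', y')); auto. }
pose proof (Rmin_l x x'); pose proof (Rmin_r x x').
pose proof (Rmax_l x x'); pose proof (Rmax_r x x').
pose proof (Rmin_l y y'); pose proof (Rmin_r y y').
pose proof (Rmax_l y y'); pose proof (Rmax_r y y').
assert (HG : circulation P Q (Rmin x x') (Rmin y y') (Rmax x x') (Rmax y y') = 0).
{ apply Goursat; try lra.
  intros [u v] [Hu Hv]; apply H, Hz; auto. }
assert (Hh : forall v, Rmin y y' <= v <= Rmax y y' -> hint P v x x' = - hint P v x' x).
{ intros v Hv; apply hint_swap, (hint_ex_sq c r); auto; apply Hz; lra. }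
assert (Hw : forall u, Rmin x x' <= u <= Rmax x x' -> vint Q u y y' = - vint Q u y' y).
{ intros u Hu; apply vint_swap, (vint_ex_sq c r); auto; apply Hz; lra. }
pose proof (Hh y ltac:(lra)); pose proof (Hh y' ltac:(lra)).
pose proof (Hw x ltac:(lra)); pose proof (Hw x' ltac:(lra)).
revert HG; unfold circulation, Rmin, Rmax.
destruct (Rle_dec x x'), (Rle_dec y y'); lra.
Qed.

(** The path through [v] and the direct one differ by the boundary of the rectangle with opposite
    corners [(fst v, snd u)] and [(fst w, snd v)], which lies in the square. *)
Lemma lint_add (c : C) (r : R) (u v w : C) :
  form_closed_on P Q (sq c r) -> sq c r u -> sq c r v -> sq c r w ->
  lint u v + lint v w = lint u w.
Proof.
intros H Hu Hv Hw.
assert (Hm : forall a b, sq c r a -> sq c r b -> sq c r (fst a, snd b)).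
{ unfold sq; simpl; tauto. }
pose proof (circulation_sq c r (fst v, snd u) (fst w, snd v) H (Hm v u Hv Hu) (Hm w v Hw Hv))
  as HC.
unfold lint, circulation in *; simpl in HC.
rewrite (hint_Chasles P (snd u) (fst u) (fst v) (fst w)),
  (vint_Chasles Q (fst w) (snd u) (snd v) (snd w)).
- lra.
- apply (vint_ex_sq c r); auto.
- apply (vint_ex_sq c r); auto.
- apply (hint_ex_sq c r); auto; apply (Hm u u) || apply (Hm v u); auto.
- apply (hint_ex_sq c r); auto.
Qed.

Lemma lint_diag (a : C) : lint a a = 0.
Proof.
unfold lint, hint, vint.
rewrite !(RInt_point (V := R_CompleteNormedModule)); apply Rplus_0_r.
Qed.

Lemma lint_swap (c : C) (r : R) (u v : C) :
  form_closed_on P Q (sq c r) -> sq c r u -> sq c r v -> lint v u = - lint u v.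
Proof.
intros H Hu Hv; pose proof (lint_add c r u v u H Hu Hv Hu) as E.
rewrite lint_diag in E; lra.
Qed.

Lemma RInt_near_const_abs (g : R -> R) (a b c e : R) :
  ex_RInt g a b -> (forall t, Rmin a b <= t <= Rmax a b -> Rabs (g t - c) <= e) ->
  Rabs (RInt g a b - c * (b - a)) <= e * Rabs (b - a).
Proof.
intros Hg H; destruct (Rle_or_lt a b) as [Hab|Hab].
- rewrite (Rabs_pos_eq (b - a)) by lra; apply RInt_near_const; auto.
  intros t Ht; apply H; rewrite Rmin_left, Rmax_right; auto.
- rewrite <- (opp_RInt_swap (V := R_CompleteNormedModule)) by (apply ex_RInt_swap, Hg).
  change (Rabs (- RInt g b a - c * (b - a)) <= e * Rabs (b - a)).
  replace (- RInt g b a - c * (b - a)) with (- (RInt g b a - c * (a - b))) by ring.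
  rewrite Rabs_Ropp, (Rabs_minus_sym b a), (Rabs_pos_eq (a - b)) by lra.
  apply RInt_near_const; [lra|apply ex_RInt_swap, Hg|].
  intros t Ht; apply H; rewrite Rmin_right, Rmax_left; lra.
Qed.

Definition is_total_differential (Phi : C -> R) (z : C) : Prop :=
  forall e, 0 < e -> exists d, 0 < d /\ forall w, sq z d w ->
    Rabs (Phi w - Phi z -
      (P (fst z) (snd z) * (fst w - fst z) + Q (fst z) (snd z) * (snd w - snd z)))
    <= e * (Rabs (fst w - fst z) + Rabs (snd w - snd z)).

(** Each leg integrates a function within [e] of its value at [z]. The vertical leg runs over
    [fst w], not [fst z], so continuity in both variables jointly is what is used. *)
Lemma lint_differential (z : C) (r : R) (Phi : C -> R) :
  0 < r -> form_closed_on P Q (sq z r) ->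
  (forall w, sq z r w -> Phi w = Phi z + lint z w) ->
  is_total_differential Phi z.
Proof.
intros Hr H HPhi e He.
destruct (closed_form_modulus P Q z e) as [d [Hd Hm]]; auto.
{ apply H, sq_center, Hr. }
exists (Rmin d r); split; [apply Rmin_pos; auto|].
intros w Hw.
assert (Hwr : sq z r w) by (apply sq_le with (2 := Hw), Rmin_r).
apply (sq_le _ _ d) in Hw; [|apply Rmin_l].
assert (Hzr := sq_center z r Hr); assert (Hzd := sq_center z d Hd).
rewrite HPhi; auto; unfold lint, hint, vint.
assert (E1 : Rabs (RInt (fun t => P t (snd z)) (fst z) (fst w) -
  P (fst z) (snd z) * (fst w - fst z)) <= e * Rabs (fst w - fst z)).
{ apply RInt_near_const_abs.
  - apply (hint_ex_sq z r); auto; unfold sq in *; simpl; tauto.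
  - intros t Ht; left; apply Hm.
    apply (rect_sq z d z (fst w, snd z)); auto.
    + unfold sq in *; simpl; tauto.
    + simpl; rewrite Rmin_left, Rmax_left; lra. }
assert (E2 : Rabs (RInt (fun t => Q (fst w) t) (snd z) (snd w) -
  Q (fst z) (snd z) * (snd w - snd z)) <= e * Rabs (snd w - snd z)).
{ apply RInt_near_const_abs.
  - apply (vint_ex_sq z r); auto; unfold sq in *; simpl; tauto.
  - intros t Ht; left; apply Hm.
    apply (rect_sq z d (fst w, snd z) w); auto.
    + unfold sq in *; simpl; tauto.
    + simpl; rewrite Rmin_left, Rmax_left; lra. }
set (A := RInt (fun t => P t (snd z)) (fst z) (fst w)) in *.
set (B := RInt (fun t => Q (fst w) t) (snd z) (snd w)) in *.
match goal with |- Rabs ?X <= _ => replace X with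
  ((A - P (fst z) (snd z) * (fst w - fst z)) +
   (B - Q (fst z) (snd z) * (snd w - snd z))) by ring end.
apply Rle_trans with (1 := Rabs_triang _ _); lra.
Qed.

End Lpath.

(** * Lattice walks and winding numbers *)

Fixpoint zsum (K : Z) (n : nat) (g : Z -> R) : R :=
  match n with O => 0 | S m => zsum K m g + g (K + Z.of_nat m)%Z end.

Lemma zsum_ext (K : Z) (n : nat) (g g' : Z -> R) :
  (forall k, g k = g' k) -> zsum K n g = zsum K n g'.
Proof. intro H; induction n; simpl; [reflexivity|rewrite IHn, H; reflexivity]. Qed.

Lemma zsum_eq0 (K : Z) (n : nat) (g : Z -> R) : (forall k, g k = 0) -> zsum K n g = 0.
Proof. intro H; induction n; simpl; [|rewrite IHn, H]; ring. Qed.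

Lemma zsum_linear (K : Z) (n : nat) (c : R) (g g' : Z -> R) :
  zsum K n (fun k => c * g k + g' k) = c * zsum K n g + zsum K n g'.
Proof. induction n; simpl; [ring|rewrite IHn; ring]. Qed.

Lemma zsum_succ (K i : Z) (g : Z -> R) :
  (K <= i)%Z -> zsum K (Z.to_nat (i + 1 - K)) g = zsum K (Z.to_nat (i - K)) g + g i.
Proof.
intro H; replace (Z.to_nat (i + 1 - K)) with (S (Z.to_nat (i - K))) by lia.
simpl; do 2 f_equal; lia.
Qed.

Lemma zsum_telescope (K i : Z) (g : Z -> R) :
  (K <= i)%Z -> zsum K (Z.to_nat (i - K)) (fun k => g (k + 1)%Z - g k) = g i - g K.
Proof.
intro H; replace i with (K + Z.of_nat (Z.to_nat (i - K)))%Z at 2 by lia.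
induction (Z.to_nat (i - K)) as [|n IH]; simpl zsum.
- rewrite Z.add_0_r; ring.
- rewrite IH; replace (K + Z.of_nat (S n))%Z with (K + Z.of_nat n + 1)%Z by lia; ring.
Qed.

Definition ind (b : bool) : R := if b then 1 else 0.

Lemma zsum_ind_lt (K i : Z) (n : nat) (g : Z -> R) :
  (K <= i <= K + Z.of_nat n)%Z ->
  zsum K n (fun k => ind (k <? i)%Z * g k) = zsum K (Z.to_nat (i - K)) g.
Proof.
intro H; replace n with (Z.to_nat (i - K) + (n - Z.to_nat (i - K)))%nat by lia.
induction (n - Z.to_nat (i - K))%nat as [|m IH].
- rewrite Nat.add_0_r.
  assert (Hle : (K + Z.of_nat (Z.to_nat (i - K)) <= i)%Z) by lia.
  revert Hle; generalize (Z.to_nat (i - K)); induction n0 as [|p IHp]; simpl zsum;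
    intro Hle; [reflexivity|].
  rewrite IHp by lia; unfold ind.
  destruct (Z.ltb_spec (K + Z.of_nat p) i); [ring|lia].
- rewrite Nat.add_succ_r; simpl zsum; rewrite IH; unfold ind.
  destruct (Z.ltb_spec (K + Z.of_nat (Z.to_nat (i - K) + m)) i); [lia|ring].
Qed.

Lemma zsum_ind_eq (K j : Z) (n : nat) (g : Z -> R) :
  (K <= j < K + Z.of_nat n)%Z -> zsum K n (fun m => ind (m =? j)%Z * g m) = g j.
Proof.
intro H.
(* The indicator of [j] is the difference of the indicators of two half-lines. *)
rewrite (zsum_ext K n _ (fun m => (-1) * (ind (m <? j)%Z * g m) + ind (m <? j + 1)%Z * g m)).
- rewrite zsum_linear, !zsum_ind_lt, zsum_succ by lia; ring.
- intro m; unfold ind.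
  destruct (Z.eqb_spec m j), (Z.ltb_spec m j), (Z.ltb_spec m (j + 1)); try lia; ring.
Qed.

(* (ei, ej) is the lower left end of the edge, whatever its orientation. *)
Record sedge := Sedge { horiz : bool; fwd : bool; ei : Z; ej : Z }.

Definition elow (e : sedge) : Z * Z := (ei e, ej e).
Definition ehigh (e : sedge) : Z * Z :=
  if horiz e then (ei e + 1, ej e)%Z else (ei e, ej e + 1)%Z.
Definition esrc (e : sedge) : Z * Z := if fwd e then elow e else ehigh e.
Definition etgt (e : sedge) : Z * Z := if fwd e then ehigh e else elow e.
Definition esign (e : sedge) : R := if fwd e then 1 else -1.

Inductive walk : Z * Z -> Z * Z -> list sedge -> Prop :=
| walk_nil u : walk u u nil
| walk_cons e v l : walk (etgt e) v l -> walk (esrc e) v (e :: l).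

Lemma walk_app (u v w : Z * Z) (l l' : list sedge) :
  walk u v l -> walk v w l' -> walk u w (l ++ l').
Proof. induction 1; simpl; auto; intro; constructor; auto. Qed.

Section Weights.

Variables ah av : Z -> Z -> R.

Definition eweight (e : sedge) : R :=
  esign e * (if horiz e then ah (ei e) (ej e) else av (ei e) (ej e)).

Fixpoint wsum (l : list sedge) : R :=
  match l with nil => 0 | e :: l => eweight e + wsum l end.

Lemma wsum_app (l l' : list sedge) : wsum (l ++ l') = wsum l + wsum l'.
Proof. induction l; simpl; [ring|rewrite IHl; ring]. Qed.

Definition curl (i j : Z) : R := ah i j + av (i + 1) j - ah i (j + 1) - av i j.

(** Sum of the weights along the path from the corner [(K, K)] up column [K], then right along the
    row of [u]. It has this meaning only for coordinates at least [K], since [Z.to_nat]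
    truncates. *)
Definition lattice_potential (K : Z) (u : Z * Z) : R :=
  zsum K (Z.to_nat (snd u - K)) (fun m => av K m) +
  zsum K (Z.to_nat (fst u - K)) (fun k => ah k (snd u)).

Definition ewind (e : sedge) (k m : Z) : R :=
  if horiz e then 0 else esign e * (ind (k <? ei e)%Z * ind (m =? ej e)%Z).

(* Winding number of l around the cell with lower left corner (k, m), as the signed
   number of crossings of a ray going right. *)
Fixpoint wind (l : list sedge) (k m : Z) : R :=
  match l with nil => 0 | e :: l => ewind e k m + wind l k m end.

(** A horizontal edge prolongs the path defining the potential. A vertical edge and the paths to its
    two ends bound the strip of cells between column [K] and the edge, whose curls telescope; these
    are the cells from column [K] on whose ray to the right crosses the edge. *)
Lemma eweight_potential (K : Z) (n : nat) (e : sedge) :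
  (K <= ei e < K + Z.of_nat n)%Z -> (K <= ej e < K + Z.of_nat n)%Z ->
  eweight e = lattice_potential K (etgt e) - lattice_potential K (esrc e) +
    zsum K n (fun k => zsum K n (fun m => ewind e k m * curl k m)).
Proof.
intros Hi Hj.
assert (Hup : (if horiz e then ah (ei e) (ej e) else av (ei e) (ej e)) =
  lattice_potential K (ehigh e) - lattice_potential K (elow e) +
  (if horiz e then 0 else zsum K (Z.to_nat (ei e - K)) (fun k => curl k (ej e)))).
{ destruct e as [[|] f i j]; unfold lattice_potential, ehigh, elow; simpl in *.
  - rewrite zsum_succ by lia; ring.
  - rewrite zsum_succ by lia.
    rewrite (zsum_ext K _ (fun k => curl k j) (fun k => 1 * (av (k + 1)%Z j - av k j) +
      ((-1) * ah k (j + 1)%Z + ah k j))) by (intro; unfold curl; ring).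
    rewrite !zsum_linear, (zsum_telescope K i (fun k => av k j)) by lia; ring. }
assert (Hw : zsum K n (fun k => zsum K n (fun m => ewind e k m * curl k m)) =
  esign e * (if horiz e then 0 else zsum K (Z.to_nat (ei e - K)) (fun k => curl k (ej e)))).
{ unfold ewind; destruct (horiz e).
  - rewrite Rmult_0_r; do 2 (apply zsum_eq0; intro); ring.
  - rewrite (zsum_ext K n _ (fun k => esign e * (ind (k <? ei e)%Z * curl k (ej e)) + 0)).
    + rewrite zsum_linear, (zsum_eq0 K n (fun _ => 0)), zsum_ind_lt by (lia || auto); ring.
    + intro k.
      rewrite (zsum_ext K n _ (fun m => (esign e * ind (k <? ei e)%Z) *
        (ind (m =? ej e)%Z * curl k m) + 0)) by (intro; ring).
      rewrite zsum_linear, (zsum_eq0 K n (fun _ => 0)), zsum_ind_eq by (lia || auto); ring. }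
rewrite Hw; unfold eweight; rewrite Hup; unfold esrc, etgt, esign; destruct (fwd e); ring.
Qed.

(** Discrete Green formula: the potential telescopes along the walk, and on a closed walk only the
    curls weighted by winding numbers remain. *)
Lemma wsum_potential (K : Z) (n : nat) (u v : Z * Z) (l : list sedge) :
  walk u v l ->
  (forall e, In e l -> (K <= ei e < K + Z.of_nat n)%Z /\ (K <= ej e < K + Z.of_nat n)%Z) ->
  wsum l = lattice_potential K v - lattice_potential K u +
    zsum K n (fun k => zsum K n (fun m => wind l k m * curl k m)).
Proof.
induction 1 as [u|e v l Hl IH]; intro Hb; simpl.
- rewrite zsum_eq0; [ring|].
  intro k; apply zsum_eq0; intro m; ring.
- rewrite IH, (eweight_potential K n e) by (try (intros; apply Hb); simpl; auto).
  rewrite (zsum_ext K n (fun k => zsum K n (fun m => (ewind e k m + wind l k m) * curl k m))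
    (fun k => 1 * zsum K n (fun m => ewind e k m * curl k m) +
              zsum K n (fun m => wind l k m * curl k m))).
  + rewrite zsum_linear; ring.
  + intro k; rewrite <- zsum_linear; apply zsum_ext; intro m; ring.
Qed.

End Weights.

Lemma sedge_bounds (l : list sedge) : exists K n, forall e, In e l ->
  (K <= ei e < K + Z.of_nat n)%Z /\ (K <= ej e < K + Z.of_nat n)%Z.
Proof.
assert (H : exists B, forall e, In e l -> (- B <= ei e <= B /\ - B <= ej e <= B)%Z).
{ induction l as [|e l [B HB]]; [exists 0%Z; intros e []|].
  exists (Z.abs B + Z.abs (ei e) + Z.abs (ej e))%Z; intros e' [<-|He']; [lia|].
  specialize (HB e' He'); lia. }
destruct H as [B HB]; exists (- B)%Z, (Z.to_nat (2 * B + 1)).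
intros e He; specialize (HB e He); lia.
Qed.

Lemma closed_walk_sum (ah av : Z -> Z -> R) (u : Z * Z) (l : list sedge) :
  walk u u l -> (forall k m, wind l k m <> 0 -> curl ah av k m = 0) ->
  wsum ah av l = 0.
Proof.
intros Hl Hz; destruct (sedge_bounds l) as [K [n Hb]].
rewrite (wsum_potential ah av K n u u l Hl Hb).
rewrite zsum_eq0; [ring|].
intro k; apply zsum_eq0; intro m.
destruct (Req_dec (wind l k m) 0) as [E|E]; [rewrite E|rewrite (Hz k m E)]; ring.
Qed.

(** The rays from two horizontally adjacent cells differ only by the edge between the cells. *)
Lemma wind_cross_vertical (l : list sedge) (k m : Z) :
  (forall e, In e l -> ~ (horiz e = false /\ elow e = (k, m))) ->
  wind l (k - 1) m = wind l k m.
Proof.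
induction l as [|e l IH]; simpl; intro H; [reflexivity|].
rewrite IH by auto; f_equal.
specialize (H e (or_introl eq_refl)); revert H; unfold ewind, elow, ind.
destruct (horiz e); [reflexivity|].
destruct (Z.ltb_spec (k - 1) (ei e)), (Z.ltb_spec k (ei e)), (Z.eqb_spec m (ej e));
  intro H'; try lia; try ring.
exfalso; apply H'; split; [|f_equal]; lia || auto.
Qed.

(** The left side counts signed entries from below, minus signed exits upwards, of the half-line of
    lattice points at height [m] strictly right of [k]. The only other way in or out is the excluded
    edge, so the count depends on the end points alone. Open walks are allowed for the sake of the
    induction. *)
Lemma wind_cross_horizontal (u v : Z * Z) (l : list sedge) (k m : Z) :
  walk u v l -> (forall e, In e l -> ~ (horiz e = true /\ elow e = (k, m))) ->
  wind l k (m - 1) - wind l k m =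
  ind ((k <? fst v) && (snd v =? m))%Z - ind ((k <? fst u) && (snd u =? m))%Z.
Proof.
induction 1 as [u|e v l Hl IH]; intro H; simpl; [ring|].
assert (IH' := IH (fun e He => H e (or_intror He))).
specialize (H e (or_introl eq_refl)).
enough (ewind e k (m - 1) - ewind e k m =
  ind ((k <? fst (etgt e)) && (snd (etgt e) =? m))%Z -
  ind ((k <? fst (esrc e)) && (snd (esrc e) =? m))%Z) by lra.
clear IH IH' Hl; revert H; destruct e as [[|] [|] i j];
  unfold ewind, esrc, etgt, ehigh, elow, esign, ind; simpl; intro H;
  try (destruct (Z.ltb_spec k i)); try (destruct (Z.ltb_spec k (i + 1)));
  try (destruct (Z.eqb_spec m j)); try (destruct (Z.eqb_spec (m - 1) j));
  try (destruct (Z.eqb_spec j m)); try (destruct (Z.eqb_spec (j + 1) m));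
  simpl; try lia; try ring; exfalso; apply H; split; auto; f_equal; lia.
Qed.

Lemma closed_wind_cross_horizontal (u : Z * Z) (l : list sedge) (k m : Z) :
  walk u u l -> (forall e, In e l -> ~ (horiz e = true /\ elow e = (k, m))) ->
  wind l k (m - 1) = wind l k m.
Proof. intros Hl H; pose proof (wind_cross_horizontal u u l k m Hl H); lra. Qed.

Lemma wind_far (l : list sedge) :
  exists K, forall k m, (K <= k)%Z -> wind l k m = 0.
Proof.
destruct (sedge_bounds l) as [B [n Hb]]; exists (B + Z.of_nat n)%Z; intros k m Hk.
induction l as [|e l IH]; simpl; [reflexivity|].
rewrite IH by (intros; apply Hb; simpl; auto).
destruct (Hb e (or_introl eq_refl)) as [He _]; unfold ewind, ind.
destruct (Z.ltb_spec k (ei e)); [lia|].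
destruct (horiz e); ring.
Qed.

(** * Potentials of closed 1-forms *)

Section Lattice.

Variables (Om : C -> Prop) (P Q : R -> R -> R) (h : R).
Hypothesis h_pos : 0 < h.

Definition lattice_point (u : Z * Z) : C := (h * IZR (fst u), h * IZR (snd u)).
Definition snap (z : C) : Z * Z := (Zfloor (fst z / h), Zfloor (snd z / h)).

Definition lattice_rect (u v : Z * Z) : C -> Prop :=
  rect (h * IZR (fst u)) (h * IZR (snd u)) (h * IZR (fst v)) (h * IZR (snd v)).
Definition cell (k m : Z) : C -> Prop := lattice_rect (k, m) (k + 1, m + 1)%Z.
Definition edges_in (l : list sedge) : Prop :=
  forall e, In e l -> forall z, lattice_rect (elow e) (ehigh e) z -> Om z.

Definition hweight (i j : Z) : R := hint P (h * IZR j) (h * IZR i) (h * IZR (i + 1)).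
Definition vweight (i j : Z) : R := vint Q (h * IZR i) (h * IZR j) (h * IZR (j + 1)).

Lemma floor_bounds (x : R) :
  h * IZR (Zfloor (x / h)) <= x < h * IZR (Zfloor (x / h) + 1).
Proof.
rewrite plus_IZR; destruct (Zfloor_bound (x / h)) as [H1 H2].
replace x with (h * (x / h)) at 2 3 by (field; lra); nra.
Qed.

Lemma lattice_le (i j : Z) : h * IZR i <= h * IZR j -> (i <= j)%Z.
Proof. intro H; apply le_IZR, (Rmult_le_reg_l h); auto. Qed.

Lemma lattice_lt (i j : Z) : h * IZR i < h * IZR j -> (i < j)%Z.
Proof. intro H; apply lt_IZR, (Rmult_lt_reg_l h); auto. Qed.

Lemma lattice_le_mono (i j : Z) : (i <= j)%Z -> h * IZR i <= h * IZR j.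
Proof. intro H; apply Rmult_le_compat_l; [lra|apply IZR_le, H]. Qed.

Lemma floor_interval (x : R) (k : Z) :
  h * IZR k <= x <= h * IZR (k + 1) ->
  k = Zfloor (x / h) \/ (k = Zfloor (x / h) - 1)%Z /\ x = h * IZR (Zfloor (x / h)).
Proof.
intro H; pose proof (floor_bounds x) as Hf; set (i := Zfloor (x / h)) in *.
assert (k < i + 1)%Z by (apply lattice_lt; lra).
assert (i <= k + 1)%Z by (apply lattice_le; lra).
destruct (Z.eq_dec k i) as [->|Hne]; [left; reflexivity|right].
assert (E : (i = k + 1)%Z) by lia; rewrite <- E in H; split; [lia|lra].
Qed.

Lemma floor_near (x : R) : exists d, 0 < d /\ forall y, Rabs (y - x) < d ->
  h * IZR (Zfloor (y / h)) <= x <= h * IZR (Zfloor (y / h) + 1).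
Proof.
pose proof (floor_bounds x) as Hx; set (i := Zfloor (x / h)) in *.
(* On a grid line [x - h * IZR i] vanishes and [y] may fall into the cell on the left, so the width
   [h] of that cell is the margin instead. *)
set (d := if Rle_dec x (h * IZR i) then h else x - h * IZR i).
assert (Hd : 0 < d) by (unfold d; destruct Rle_dec; lra).
exists (Rmin d (h * IZR (i + 1) - x)); split; [apply Rmin_pos; lra|].
intros y Hy; apply Rabs_def2 in Hy.
pose proof (Rmin_l d (h * IZR (i + 1) - x)); pose proof (Rmin_r d (h * IZR (i + 1) - x)).
pose proof (floor_bounds y) as Hf; set (j := Zfloor (y / h)) in *.
assert (j < i + 1)%Z by (apply lattice_lt; lra).
assert (j <= i)%Z as Hji by lia; apply lattice_le_mono in Hji; split; [lra|].
unfold d in *; destruct Rle_dec as [Hle|Hle].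
- assert (i - 1 < j + 1)%Z by (apply lattice_lt; rewrite minus_IZR; lra).
  assert (i <= j + 1)%Z as Hij by lia; apply lattice_le_mono in Hij; lra.
- assert (i < j + 1)%Z by (apply lattice_lt; lra).
  assert (i + 1 <= j + 1)%Z as Hij by lia; apply lattice_le_mono in Hij; lra.
Qed.

Lemma snap_sq (z : C) (d : R) : h < d -> sq z d (lattice_point (snap z)).
Proof.
intro Hd; unfold sq, lattice_point, snap; simpl.
pose proof (floor_bounds (fst z)) as H1; pose proof (floor_bounds (snd z)) as H2.
rewrite plus_IZR in H1, H2; split; apply Rabs_def1; lra.
Qed.

(** Neighbouring closed cells that share [z] have [z] on the edge between them; as [z] is outside
    [Om], the walk avoids this edge and the winding number does not jump. *)
Lemma wind_cell (u : Z * Z) (l : list sedge) (z : C) (k m : Z) :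
  walk u u l -> edges_in l -> ~ Om z -> cell k m z ->
  wind l k m = wind l (fst (snap z)) (snd (snap z)).
Proof.
intros Hw Hl Hz [Hx Hy]; simpl in Hx, Hy.
pose proof (floor_bounds (fst z)) as Fx; pose proof (floor_bounds (snd z)) as Fy.
apply floor_interval in Hx; unfold snap; simpl.
set (i := Zfloor (fst z / h)) in *.
transitivity (wind l i m).
- destruct Hx as [->|[-> Ex]]; [reflexivity|].
  apply wind_cross_vertical; intros e He [E1 E2]; apply Hz, (Hl e He).
  unfold elow, ehigh in *; injection E2 as -> ->; rewrite E1; split; simpl; lra.
- apply floor_interval in Hy; set (j := Zfloor (snd z / h)) in *.
  destruct Hy as [->|[-> Ey]]; [reflexivity|].
  apply closed_wind_cross_horizontal with u; auto.
  intros e He [E1 E2]; apply Hz, (Hl e He).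
  unfold elow, ehigh in *; injection E2 as -> ->; rewrite E1; split; simpl; lra.
Qed.

Lemma snap_near (z : C) : exists d, 0 < d /\ forall w, sq z d w ->
  cell (fst (snap w)) (snd (snap w)) z.
Proof.
destruct (floor_near (fst z)) as [d1 [Hd1 H1]].
destruct (floor_near (snd z)) as [d2 [Hd2 H2]].
exists (Rmin d1 d2); split; [apply Rmin_pos; auto|].
intros w [W1 W2]; pose proof (Rmin_l d1 d2); pose proof (Rmin_r d1 d2).
split; simpl; [apply H1|apply H2]; lra.
Qed.

Lemma wind_outside (u : Z * Z) (l : list sedge) (z : C) (k m : Z) :
  bounded_set Om -> clopen_rigid (fun z => ~ Om z) ->
  walk u u l -> edges_in l -> ~ Om z -> cell k m z -> wind l k m = 0.
Proof.
intros [r Hr] Hrig Hw Hl Hz Hc.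
rewrite (wind_cell u l z k m) by auto.
set (g := fun w => wind l (fst (snap w)) (snd (snap w))).
(* [near A] is the interior of the preimage of [A] under [g]. Interiors are open and disjoint in the
   whole plane, although [g] may jump inside [Om]. *)
set (near := fun (A : R -> Prop) z => exists d, 0 < d /\ forall w, sq z d w -> A (g w)).
assert (Hopen : forall A, open (near A)).
{ intro A; apply open_sq; intros w [d [Hd HA]].
  exists (d / 2); split; [lra|]; intros v Hv; exists (d / 2); split; [lra|].
  intros x Hx; apply HA.
  destruct Hv as [V1 V2], Hx as [X1 X2].
  apply Rabs_def2 in V1; apply Rabs_def2 in V2.
  apply Rabs_def2 in X1; apply Rabs_def2 in X2; split; apply Rabs_def1; lra. }
assert (Hself : forall A w, near A w -> A (g w)).
{ intros A w [d [Hd HA]]; apply HA, sq_center, Hd. }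
assert (Hconst : forall A w, ~ Om w -> A (g w) -> near A w).
{ intros A w Ow Aw; destruct (snap_near w) as [d [Hd H]].
  exists d; split; auto; intros v Hv; unfold g.
  rewrite (wind_cell u l w) by auto; exact Aw. }
apply (Hself (fun x => x = 0)).
apply (Hrig (near (fun x => x = 0)) (near (fun x => x <> 0))); auto.
- intros w [H1 H2]; exact (Hself _ w H2 (Hself _ w H1)).
- intros w Ow; destruct (classic (g w = 0)) as [E|E]; [left|right]; auto.
- destruct (wind_far l) as [K HK].
  (* Far enough to the right to be outside [Om] and past every edge of the walk. *)
  set (x := Rmax (Rabs r + 1) (h * IZR K)).
  pose proof (Rmax_l (Rabs r + 1) (h * IZR K)) as X1.
  pose proof (Rmax_r (Rabs r + 1) (h * IZR K)) as X2.
  fold x in X1, X2.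
  assert (Ox : ~ Om (x, 0)).
  { intro O; apply Hr in O; pose proof (re_le_Cmod (x, 0)) as Hre; change (Re (x, 0)) with x in Hre.
    pose proof (Rle_trans _ _ _ Hre O); pose proof (Rle_abs r); pose proof (Rle_abs x); lra. }
  exists (x, 0); split; auto.
  apply Hconst; auto; unfold g; apply HK; simpl.
  pose proof (floor_bounds x).
  assert (K < Zfloor (x / h) + 1)%Z by (apply lattice_lt; lra); lia.
Qed.

Lemma closed_lattice_walk (u : Z * Z) (l : list sedge) :
  bounded_set Om -> clopen_rigid (fun z => ~ Om z) -> form_closed_on P Q Om ->
  walk u u l -> edges_in l -> wsum hweight vweight l = 0.
Proof.
intros Hb Hrig Hcl Hw Hl; apply closed_walk_sum with u; auto.
intros k m Hkm.
(* For these weights [curl] unfolds to the circulation around the cell. *)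
apply (Goursat P Q (h * IZR k) (h * IZR m) (h * IZR (k + 1)) (h * IZR (m + 1)));
  try (apply lattice_le_mono; lia).
intros z Hz; apply Hcl, NNPP; intro Oz; apply Hkm.
apply (wind_outside u l z); auto.
Qed.

Lemma edge_in_square (c : C) (r : R) (e : sedge) :
  form_closed_on P Q (sq c r) ->
  sq c r (lattice_point (esrc e)) -> sq c r (lattice_point (etgt e)) ->
  (forall z, lattice_rect (elow e) (ehigh e) z -> sq c r z) /\
  eweight hweight vweight e = lint P Q (lattice_point (esrc e)) (lattice_point (etgt e)).
Proof.
intros H Hs Ht.
assert (Hlh : sq c r (lattice_point (elow e)) /\ sq c r (lattice_point (ehigh e))).
{ unfold esrc, etgt in *; destruct (fwd e); auto. }
destruct Hlh as [Hlo Hhi]; split.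
- intros z [Hx Hy]; apply (rect_sq c r _ _ z Hlo Hhi); simpl in *.
  + rewrite Rmin_left, Rmax_right by lra; exact Hx.
  + rewrite Rmin_left, Rmax_right by lra; exact Hy.
- assert (E : lint P Q (lattice_point (elow e)) (lattice_point (ehigh e)) =
    if horiz e then hweight (ei e) (ej e) else vweight (ei e) (ej e)).
  { unfold lint, hweight, vweight, elow, ehigh, hint, vint; destruct (horiz e); simpl;
      rewrite (RInt_point (V := R_CompleteNormedModule));
      [apply Rplus_0_r|apply Rplus_0_l]. }
  unfold eweight, esign, esrc, etgt in *; rewrite <- E; destruct (fwd e); [ring|].
  rewrite (lint_swap P Q c r _ _ H Hlo Hhi); ring.
Qed.

(** Induction on the lattice distance: each edge moves towards [v] within the bounding box of [u]
    and [v], hence inside the square, where L-shaped integrals add up. *)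
Lemma square_walk (c : C) (r : R) (v : Z * Z) :
  form_closed_on P Q (sq c r) -> (forall z, sq c r z -> Om z) ->
  sq c r (lattice_point v) ->
  forall (n : nat) (u : Z * Z),
  (Z.abs (fst v - fst u) + Z.abs (snd v - snd u) <= Z.of_nat n)%Z ->
  sq c r (lattice_point u) ->
  exists l, walk u v l /\ edges_in l /\
    wsum hweight vweight l = lint P Q (lattice_point u) (lattice_point v).
Proof.
intros H HOm Hv; induction n as [|n IH]; intros [i j] Hn Hu; destruct v as [i' j'];
  simpl fst in *; simpl snd in *.
- assert (i' = i) by lia; assert (j' = j) by lia; subst.
  exists nil; split; [constructor|split; [intros e []|]].
  rewrite lint_diag; reflexivity.
- destruct (Z.eq_dec i i') as [Ei|Ni]; [destruct (Z.eq_dec j j') as [Ej|Nj]|].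
  { subst; exists nil; split; [constructor|split; [intros e []|]].
    rewrite lint_diag; reflexivity. }
  all: assert (He : exists e, esrc e = (i, j) /\
    (Z.min i i' <= fst (etgt e) <= Z.max i i')%Z /\
    (Z.min j j' <= snd (etgt e) <= Z.max j j')%Z /\
    (Z.abs (i' - fst (etgt e)) + Z.abs (j' - snd (etgt e)) <= Z.of_nat n)%Z).
  1: { destruct (Z_lt_le_dec j j').
       - exists (Sedge false true i j); simpl; repeat split; lia.
       (* A backward edge is named by its lower end, hence [j - 1]. *)
       - exists (Sedge false false i (j - 1)); unfold esrc, etgt, ehigh, elow; simpl;
           repeat split; try lia; f_equal; lia. }
  2: { destruct (Z_lt_le_dec i i').
       - exists (Sedge true true i j); simpl; repeat split; lia.
       - exists (Sedge true false (i - 1) j); unfold esrc, etgt, ehigh, elow; simpl;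
           repeat split; try lia; f_equal; lia. }
  all: destruct He as [e [Es [Hx [Hy Hd]]]].
  all: assert (Ht : sq c r (lattice_point (etgt e))) by
    (apply (rect_sq c r _ _ _ Hu Hv); simpl;
     unfold Rmin, Rmax; repeat destruct Rle_dec;
     split; apply lattice_le_mono;
     repeat match goal with
     | A : h * IZR _ <= h * IZR _ |- _ => apply lattice_le in A
     | A : ~ h * IZR _ <= h * IZR _ |- _ => apply Rnot_le_lt, lattice_lt in A
     end; lia).
  all: destruct (IH (etgt e) Hd Ht) as [l [Wl [Il Sl]]].
  all: exists (e :: l); rewrite <- Es in Hu |- *;
    destruct (edge_in_square c r e H Hu Ht) as [Ie We];
    (split; [constructor; exact Wl|split]);
    [intros e' [<-|He']; [intros z Hz; apply HOm, Ie, Hz|apply Il, He']|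
     simpl; rewrite We, Sl; apply (lint_add P Q c r); auto].
Qed.

End Lattice.

Section Potential.

Variables (Om : C -> Prop) (P Q : R -> R -> R).
Hypothesis Om_open : open Om.
Hypothesis Om_closed_form : form_closed_on P Q Om.

(** The accumulated integral is an index of the relation. Only consecutive points sharing a square
    matter, so no path has to be parametrized. *)
Inductive chain : C -> C -> R -> Prop :=
| chain_nil a : chain a a 0
| chain_cons c r a b z s :
    (forall w, sq c r w -> Om w) -> sq c r a -> sq c r b ->
    chain b z s -> chain a z (lint P Q a b + s).

Lemma form_closed_sq (c : C) (r : R) :
  (forall w, sq c r w -> Om w) -> form_closed_on P Q (sq c r).
Proof. intros H z Hz; apply Om_closed_form, H, Hz. Qed.

Lemma chain_one (c : C) (r : R) (a b : C) :
  (forall w, sq c r w -> Om w) -> sq c r a -> sq c r b -> chain a b (lint P Q a b).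
Proof.
intros H Ha Hb; rewrite <- (Rplus_0_r (lint P Q a b)).
apply chain_cons with c r; auto; constructor.
Qed.

Lemma chain_app (a b c : C) (s t : R) :
  chain a b s -> chain b c t -> chain a c (s + t).
Proof.
induction 1; intro Ht; [rewrite Rplus_0_l; auto|].
rewrite Rplus_assoc; apply chain_cons with c0 r; auto.
Qed.

Lemma chain_rev (a b : C) (s : R) : chain a b s -> chain b a (- s).
Proof.
induction 1 as [a|c r a b z s Hsq Ha Hb Hc IH]; [rewrite Ropp_0; constructor|].
replace (- (lint P Q a b + s)) with (- s + lint P Q b a).
- apply chain_app with b; auto; apply chain_one with c r; auto.
- rewrite (lint_swap P Q c r a b) by (try apply form_closed_sq; auto); ring.
Qed.

(** The squares are open, so for a small mesh the points of the chain snap to the lattice without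
    leaving their squares. The corrections at intermediate points cancel, and those at the two ends
    remain. *)
Lemma chain_snap (a b : C) (s : R) :
  chain a b s -> exists d, 0 < d /\ forall h, 0 < h < d ->
  exists l, walk (snap h a) (snap h b) l /\ edges_in Om h l /\
    s = lint P Q a (lattice_point h (snap h a)) + wsum (hweight P h) (vweight Q h) l -
        lint P Q b (lattice_point h (snap h b)).
Proof.
induction 1 as [a|c r a b z s Hsq Ha Hb Hc [d [Hd IH]]].
- exists 1; split; [lra|]; intros h Hh; exists nil.
  split; [constructor|split; [intros e []|simpl; ring]].
- destruct (sq_sub c r a Ha) as [d1 [Hd1 H1]].
  destruct (sq_sub c r b Hb) as [d2 [Hd2 H2]].
  exists (Rmin d (Rmin d1 d2)); split; [repeat apply Rmin_pos; auto|].
  intros h [Hh Hhd].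
  pose proof (Rmin_l d (Rmin d1 d2)); pose proof (Rmin_r d (Rmin d1 d2)).
  pose proof (Rmin_l d1 d2); pose proof (Rmin_r d1 d2).
  destruct (IH h ltac:(lra)) as [l [Wl [Il Sl]]].
  assert (Sa : sq c r (lattice_point h (snap h a))) by (apply H1, snap_sq; lra).
  assert (Sb : sq c r (lattice_point h (snap h b))) by (apply H2, snap_sq; lra).
  assert (HF := form_closed_sq c r Hsq).
  destruct (square_walk Om P Q h Hh c r (snap h b) HF Hsq Sb
    (Z.to_nat (Z.abs (fst (snap h b) - fst (snap h a)) +
               Z.abs (snd (snap h b) - snd (snap h a)))) (snap h a)) as [l' [Wl' [Il' Sl']]];
    [lia|exact Sa|].
  exists (l' ++ l); split; [apply walk_app with (snap h b); auto|split].
  + intros e He; apply in_app_or in He; destruct He; [apply Il'|apply Il]; auto.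
  + rewrite wsum_app, Sl', Sl.
    rewrite <- (lint_add P Q c r a (lattice_point h (snap h a)) b) by auto.
    rewrite <- (lint_add P Q c r (lattice_point h (snap h a)) (lattice_point h (snap h b)) b)
      by auto.
    rewrite (lint_swap P Q c r b (lattice_point h (snap h b))) by auto; ring.
Qed.

Lemma closed_chain (a : C) (s : R) :
  bounded_set Om -> clopen_rigid (fun z => ~ Om z) -> chain a a s -> s = 0.
Proof.
intros Hb Hrig Hs; destruct (chain_snap a a s Hs) as [d [Hd H]].
destruct (H (d / 2)) as [l [Wl [Il ->]]]; [lra|].
rewrite (closed_lattice_walk Om P Q (d / 2) ltac:(lra) (snap (d / 2) a)) by auto; ring.
Qed.

Lemma chain_unique (a b : C) (s t : R) :
  bounded_set Om -> clopen_rigid (fun z => ~ Om z) -> chain a b s -> chain a b t -> s = t.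
Proof.
intros Hb Hrig Hs Ht.
pose proof (closed_chain a (s + - t) Hb Hrig
  (chain_app _ _ _ _ _ Hs (chain_rev _ _ _ Ht))); lra.
Qed.

Lemma chain_exists (a b : C) :
  connected Om -> Om a -> Om b -> exists s, chain a b s.
Proof.
intros Hconn Oa Ob; apply NNPP; intro Hn.
assert (Hmove : forall z, Om z -> exists d, 0 < d /\ forall w, sq z d w -> Om w /\
  ((exists s, chain a z s) <-> exists s, chain a w s)).
{ intros z Oz; destruct (proj1 (open_sq Om) Om_open z Oz) as [d [Hd H]].
  exists d; split; auto; intros w Hw; split; [auto|].
  pose proof (sq_center z d Hd) as Hz; split; intros [s Hs].
  - exists (s + lint P Q z w); apply chain_app with z; auto; apply chain_one with z d; auto.
  - exists (s + lint P Q w z); apply chain_app with w; auto; apply chain_one with z d; auto. }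
(* The points of a square inside [Om] are reachable from [a] all together or not at all, so both
   sets are open. *)
destruct (Hconn (fun z => Om z /\ exists s, chain a z s)
                (fun z => Om z /\ ~ exists s, chain a z s)) as [z Hz].
- apply open_sq; intros z [Oz Hz]; destruct (Hmove z Oz) as [d [Hd H]].
  exists d; split; auto; intros w Hw; specialize (H w Hw); tauto.
- apply open_sq; intros z [Oz Hz]; destruct (Hmove z Oz) as [d [Hd H]].
  exists d; split; auto; intros w Hw; specialize (H w Hw); tauto.
- intros z Oz; destruct (classic (exists s, chain a z s)); auto.
- exists a; split; auto; split; auto; exists 0; constructor.
- exists b; auto.
- tauto.
Qed.

Theorem closed_form_exact :
  connected Om -> bounded_set Om -> clopen_rigid (fun z => ~ Om z) ->
  (exists z, Om z) ->
  exists Phi, forall z, Om z -> is_total_differential P Q Phi z.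
Proof.
intros Hconn Hb Hrig [a Oa].
(* By [chain_unique] the choice of the chain from [a] does not affect the value on [Om]; elsewhere
   the value is irrelevant. *)
exists (fun z => epsilon (inhabits 0) (fun s => chain a z s)); intros z Oz.
assert (Hch : forall w, Om w ->
  chain a w (epsilon (inhabits 0) (fun s => chain a w s))).
{ intros w Ow; apply epsilon_spec, chain_exists; auto. }
destruct (proj1 (open_sq Om) Om_open z Oz) as [d [Hd H]].
apply lint_differential with d; [exact Hd|apply form_closed_sq; auto|].
intros w Hw; apply (chain_unique a w); auto.
apply chain_app with z; auto; apply chain_one with z d; auto; apply sq_center, Hd.
Qed.

End Potential.

(** * Complex antiderivatives *)

Lemma Cmod_le_abs (z : C) : Cmod z <= Rabs (fst z) + Rabs (snd z).
Proof.
pose proof (Rabs_pos (fst z)); pose proof (Rabs_pos (snd z)).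
unfold Cmod; rewrite <- (sqrt_pow2 (Rabs (fst z) + Rabs (snd z))) by lra.
apply sqrt_le_1_alt; rewrite <- (pow2_abs (fst z)), <- (pow2_abs (snd z)); nra.
Qed.

Lemma abs_le_Cmod (z : C) : Rabs (fst z) <= Cmod z /\ Rabs (snd z) <= Cmod z.
Proof.
pose proof (Rmax_Cmod z); pose proof (Rmax_l (Rabs (fst z)) (Rabs (snd z))).
pose proof (Rmax_r (Rabs (fst z)) (Rabs (snd z))); lra.
Qed.

(** [is_derive] takes neighbourhoods for [Cmod], the other sections take squares; the radius is
    halved because [Cmod] is bounded by the sum of the two coordinates. *)
Lemma is_derive_sq (f : C -> C) (z l : C) :
  @is_derive C_AbsRing C_NormedModule f z l <->
  forall e, 0 < e -> exists d, 0 < d /\ forall w, sq z d w ->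
    Cmod (f w - f z - (w - z) * l)%C <= e * Cmod (w - z)%C.
Proof.
split.
- intros [_ H] e He.
  destruct (H z (fun P HP => HP) (mkposreal e He)) as [d Hd].
  exists (d / 2); split; [pose proof (cond_pos d); lra|].
  intros w [W1 W2]; apply (Hd w).
  change (Cmod (w - z)%C < d).
  apply Rle_lt_trans with (1 := Cmod_le_abs _).
  simpl; unfold Rminus in W1, W2; lra.
- intro H; split; [apply is_linear_scal_l|].
  intros x Hx.
  assert (E : x = z) by (symmetry; apply is_filter_lim_locally_unique, Hx); subst x.
  intro e; destruct (H e (cond_pos e)) as [d [Hd Hw]].
  exists (mkposreal d Hd); intros w Hb; apply (Hw w).
  change (Cmod (w - z)%C < d) in Hb.
  destruct (abs_le_Cmod (w - z)%C) as [H1 H2]; simpl in H1, H2.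
  unfold sq, Rminus; lra.
Qed.

(** With [f = u + i v], these are the real part [u dx - v dy] and the imaginary part [v dx + u dy]
    of [f dz]. If the derivative is [p + i q], then [u] has gradient [(p, -q)] and [v] has gradient
    [(q, p)], so both Jacobians are symmetric. *)
Lemma derivative_closed_forms (f : C -> C) (z : C) :
  @ex_derive C_AbsRing C_NormedModule f z ->
  closed_form_at (fun x y => fst (f (x, y))) (fun x y => - snd (f (x, y))) z /\
  closed_form_at (fun x y => snd (f (x, y))) (fun x y => fst (f (x, y))) z.
Proof.
intros [[p q] Hl]; rewrite is_derive_sq in Hl.
assert (H : forall e, 0 < e -> exists d, 0 < d /\ forall u v, sq z d (u, v) ->
  Rabs (fst (f (u, v)) - fst (f z) - (p * (u - fst z) - q * (v - snd z)))
    <= e * (Rabs (u - fst z) + Rabs (v - snd z)) /\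
  Rabs (snd (f (u, v)) - snd (f z) - (q * (u - fst z) + p * (v - snd z)))
    <= e * (Rabs (u - fst z) + Rabs (v - snd z))).
{ intros e He; destruct (Hl e He) as [d [Hd H]]; exists d; split; auto.
  intros u v Huv; specialize (H _ Huv).
  pose proof (Cmod_le_abs ((u, v) - z)%C) as Hm; simpl in Hm.
  destruct (abs_le_Cmod (f (u, v) - f z - ((u, v) - z) * (p, q))%C) as [H1 H2].
  simpl in H1, H2.
  assert (Hb : e * Cmod ((u, v) - z)%C <= e * (Rabs (u - fst z) + Rabs (v - snd z))).
  { apply Rmult_le_compat_l; [lra|exact Hm]. }
  split.
  - apply Rle_trans with (2 := Hb), Rle_trans with (2 := H), Rle_trans with (2 := H1).
    right; f_equal; ring.
  - apply Rle_trans with (2 := Hb), Rle_trans with (2 := H), Rle_trans with (2 := H2).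
    right; f_equal; ring. }
destruct z as [x y]; simpl in *; split.
- exists p, (- q), (- p); intros e He; destruct (H e He) as [d [Hd Hw]].
  exists d; split; auto; intros u v Huv; destruct (Hw u v Huv) as [H1 H2]; simpl in *; split.
  + apply Rle_trans with (2 := H1); right; f_equal; ring.
  + apply Rle_trans with (2 := H2); right; rewrite <- Rabs_Ropp; f_equal; ring.
- exists q, p, (- q); intros e He; destruct (H e He) as [d [Hd Hw]].
  exists d; split; auto; intros u v Huv; destruct (Hw u v Huv) as [H1 H2]; simpl in *; split.
  + apply Rle_trans with (2 := H2); right; f_equal; ring.
  + apply Rle_trans with (2 := H1); right; f_equal; ring.
Qed.

Lemma total_differentials_derivative (f : C -> C) (Phi Psi : C -> R) (z : C) :
  is_total_differential (fun x y => fst (f (x, y))) (fun x y => - snd (f (x, y))) Phi z ->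
  is_total_differential (fun x y => snd (f (x, y))) (fun x y => fst (f (x, y))) Psi z ->
  @is_derive C_AbsRing C_NormedModule (fun w => (Phi w, Psi w)) z (f z).
Proof.
intros H1 H2; apply is_derive_sq; intros e He.
(* There are two remainders, each [e / 4] times a sum of two coordinates that are at most
   [Cmod (w - z)]. *)
destruct (H1 (e / 4)) as [d1 [Hd1 D1]]; [lra|].
destruct (H2 (e / 4)) as [d2 [Hd2 D2]]; [lra|].
exists (Rmin d1 d2); split; [apply Rmin_pos; auto|].
intros w Hw.
specialize (D1 w (sq_le _ _ _ _ (Rmin_l d1 d2) Hw)).
specialize (D2 w (sq_le _ _ _ _ (Rmin_r d1 d2) Hw)).
destruct (abs_le_Cmod (w - z)%C) as [A1 A2]; simpl in A1, A2.
destruct w as [u v], z as [x y]; simpl in *.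
apply Rle_trans with (1 := Cmod_le_abs _); simpl.
match goal with |- Rabs ?X + Rabs ?Y <= _ =>
  replace X with (Phi (u, v) - Phi (x, y) -
    (fst (f (x, y)) * (u - x) + - snd (f (x, y)) * (v - y))) by ring;
  replace Y with (Psi (u, v) - Psi (x, y) -
    (snd (f (x, y)) * (u - x) + fst (f (x, y)) * (v - y))) by ring
end.
unfold Rminus in *; nra.
Qed.

Lemma antiderivative_exists (Om : C -> Prop) (f : C -> C) :
  Jordan_domain Om -> holomorphic_on Om f -> exists F, is_antiderivative_on Om f F.
Proof.
intros HJ Hf.
assert (Hopen := Jordan_domain_open Om HJ).
assert (Hrig := Jordan_domain_compl_clopen Om HJ).
destruct HJ as [J [_ [[Hne [_ [Hconn _]]] Hb]]].
destruct (closed_form_exact Om (fun x y => fst (f (x, y))) (fun x y => - snd (f (x, y))))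
  as [Phi HPhi]; auto.
{ intros z Oz; apply derivative_closed_forms, Hf, Oz. }
destruct (closed_form_exact Om (fun x y => snd (f (x, y))) (fun x y => fst (f (x, y))))
  as [Psi HPsi]; auto.
{ intros z Oz; apply derivative_closed_forms, Hf, Oz. }
exists (fun w => (Phi w, Psi w)); intros z Oz.
apply total_differentials_derivative; auto.
Qed.

Lemma antiderivative_locally_Lipschitz (Om : C -> Prop) (f F : C -> C) (B : R) (z : C) :
  is_antiderivative_on Om f F -> (forall w, Om w -> Cmod (f w) <= B) -> Om z ->
  exists d, 0 < d /\ forall w, sq z d w ->
    Cmod (F w - F z)%C <= (B + 1) * Cmod (w - z)%C.
Proof.
intros HF HB Oz.
destruct (proj1 (is_derive_sq F z (f z)) (HF z Oz) 1 Rlt_0_1) as [d [Hd H]].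
exists d; split; auto; intros w Hw; specialize (H w Hw); specialize (HB z Oz).
replace (F w - F z)%C with (F w - F z - (w - z) * f z + (w - z) * f z)%C by ring.
apply Rle_trans with (1 := Cmod_triangle _ _); rewrite Cmod_mult.
pose proof (Cmod_ge_0 (w - z)%C); nra.
Qed.

Lemma inscribed_length_bound (Om : C -> Prop) (F : C -> C) (g : R -> C) (a b : C) (L : R) :
  0 <= L -> curve_in Om g a b ->
  (forall z, Om z -> exists d, 0 < d /\ forall w, sq z d w ->
    Cmod (F w - F z)%C <= L * Cmod (w - z)%C) ->
  exists l, inscribed_length g l /\ Cmod (F b - F a)%C <= L * l.
Proof.
intros HL [Hg [HOm [<- <-]]] HF.
set (S := fun t => exists (n : nat) (p : nat -> R),
  p 0%nat = 0 /\ p (Datatypes.S n) = t /\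
  (forall k, (k <= n)%nat -> p k <= p (Datatypes.S k)) /\
  Cmod (F (g t) - F (g 0))%C <=
    L * sum_f_R0 (fun k => Cmod (g (p (Datatypes.S k)) - g (p k))%C) n).
assert (Hext : forall s t, s <= t ->
  Cmod (F (g t) - F (g s))%C <= L * Cmod (g t - g s)%C -> S s -> S t).
{ intros s t Hst Hlip [n [p [P0 [Pn [Pm Pl]]]]].
  (* The nodes up to index [n + 1] are kept and [t] becomes node [n + 2]. *)
  exists (Datatypes.S n), (fun k => if (k <=? Datatypes.S n)%nat then p k else t).
  assert (E : forall k, (k <= Datatypes.S n)%nat -> (k <=? Datatypes.S n)%nat = true).
  { intros k Hk; apply Nat.leb_le, Hk. }
  assert (E' : (Datatypes.S (Datatypes.S n) <=? Datatypes.S n)%nat = false).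
  { apply Nat.leb_gt; lia. }
  split; [exact P0|split; [rewrite E'; reflexivity|split]].
  - intros k Hk; destruct (Nat.eq_dec k (Datatypes.S n)) as [->|Hne].
    + rewrite E, E', Pn by lia; exact Hst.
    + rewrite !E by lia; apply Pm; lia.
  - rewrite tech5, E', E, Pn by lia.
    rewrite (sum_eq _ (fun k => Cmod (g (p (Datatypes.S k)) - g (p k))%C) n).
    + replace (F (g t) - F (g 0))%C with
        (F (g s) - F (g 0) + (F (g t) - F (g s)))%C by ring.
      apply Rle_trans with (1 := Cmod_triangle _ _); lra.
    + intros k Hk; rewrite !E by lia; reflexivity. }
assert (H1 : S 1).
{ apply interval_induction; [lra| |].
  - exists 0%nat, (fun _ => 0); repeat split; [intros; lra|simpl].
    replace (F (g 0%R) - F (g 0%R))%C with (RtoC 0) by ring.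
    rewrite Cmod_0; apply Rmult_le_pos, Cmod_ge_0; exact HL.
  - intros t Ht; destruct (HF (g t) (HOm t Ht)) as [e [He Hlip]].
    destruct (continuous_on_sq g t e Hg Ht He) as [d [Hd Hc]].
    exists d; split; auto; intros s u Hs Hu Hsd Hud Ss.
    (* The local estimate has [g t] as one end, so the partition passes from [s] to [u] through
       [t]. *)
    apply (Hext t u); [lra| |apply (Hext s t); [lra| |exact Ss]].
    + apply Hlip, Hc; [unfold unit_interval; lra|apply Rabs_def1; lra].
    + assert (Hlip' := Hlip (g s)).
      rewrite <- (Cmod_opp (F (g t) - F (g s))%C), <- (Cmod_opp (g t - g s)%C).
      replace (- (F (g t) - F (g s)))%C with (F (g s) - F (g t))%C by ring.
      replace (- (g t - g s))%C with (g s - g t)%C by ring.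
      apply Hlip', Hc; [unfold unit_interval; lra|apply Rabs_def1; lra]. }
destruct H1 as [n [p [P0 [Pn [Pm Pl]]]]].
eexists; split; [|exact Pl].
exists n, p; auto.
Qed.

Theorem proposition6p1 (Omega : C -> Prop) (f : C -> C)
  (hOmega : Jordan_domain Omega)
  (hM : exists M : R, forall a b : C, Omega a -> Omega b ->
          exists gamma : R -> C,
            curve_in Omega gamma a b /\ Rbar_le (curve_length gamma) (Finite M))
  (hf : holomorphic_on Omega f)
  (hfb : bounded_on Omega f) :
  (exists F : C -> C, is_antiderivative_on Omega f F) /\
  (forall F : C -> C, is_antiderivative_on Omega f F ->
     holomorphic_on Omega F /\ bounded_on Omega F).
Proof.
split; [apply antiderivative_exists; auto|].
intros F HF; split; [intros z Oz; exists (f z); apply HF, Oz|].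
destruct hOmega as [J [_ [[[a Oa] _] _]]].
destruct hM as [M HM]; destruct hfb as [B HB].
assert (HB0 : 0 <= B) by (apply Rle_trans with (1 := Cmod_ge_0 (f a)), HB, Oa).
exists (Cmod (F a) + (B + 1) * M); intros z Oz.
destruct (HM a z Oa Oz) as [g [Hg HgM]].
destruct (inscribed_length_bound Omega F g a z (B + 1)) as [l [Hl Hlip]]; [lra|exact Hg| |].
{ intros w Ow; apply (antiderivative_locally_Lipschitz Omega f); auto. }
assert (HlM : l <= M).
{ apply (Rbar_le_trans l (curve_length g) M); [|exact HgM].
  apply (proj1 (Lub_Rbar_correct (inscribed_length g))), Hl. }
replace (F z) with (F a + (F z - F a))%C by ring.
apply Rle_trans with (1 := Cmod_triangle _ _); nra.
Qed.
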